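(* Let $\mathcal{A}$ be an abelian category with subcategories $\mathcal{X},\mathcal{Y},\mathcal{W},\mathcal{V}$ such that $\mathcal{W}\subseteq\mathcal{X}$ and $\mathcal{V}\subseteq\mathcal{Y}$. Assume that $\mathcal{X}$ and $\mathcal{Y}$ are closed under extensions, $\mathcal{W}$ is an injective cogenerator for $\mathcal{X}$, $\mathcal{V}$ is a projective generator for $\mathcal{Y}$, $\mathcal{W}\perp\mathcal{Y}$, $\mathcal{X}\perp\mathcal{V}$, and $\operatorname{Ext}^{\geq1}_{\mathcal{W}\mathcal{A}}(\operatorname{res}\widehat{\mathcal{W}},\mathcal{V})=0=\operatorname{Ext}^{\geq1}_{\mathcal{A}\mathcal{V}}(\mathcal{W},\operatorname{cores}\widehat{\mathcal{V}})$. Then $\operatorname{Ext}_{\mathcal{X}\mathcal{A}}$ and $\operatorname{Ext}_{\mathcal{A}\mathcal{Y}}$ are balanced on $\operatorname{res}\widehat{\mathcal{X}}\times\operatorname{cores}\widehat{\mathcal{Y}}$. In particular, there are isomorphisms $\operatorname{Ext}^n_{\mathcal{X}\mathcal{A}}(M,N)\cong\operatorname{Ext}^n_{\mathcal{A}\mathcal{Y}}(M,N)$ for all objects $M$ in $\operatorname{res}\widehat{\mathcal{X}}$ and $N$ in $\operatorname{cores}\widehat{\mathcal{Y}}$ and for all $n\in\mathbb{Z}$.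
   Context: ''Subcategory'' means full, additive subcategory closed under isomorphisms. For classes $\mathcal{C},\mathcal{D}$ of objects of $\mathcal{A}$, $\mathcal{C}\perp\mathcal{D}$ means $\operatorname{Ext}^i_{\mathcal{A}}(C,D)=0$ for all $i\geq1$, $C\in\mathcal{C}$, $D\in\mathcal{D}$. $\mathcal{W}$ is a cogenerator for $\mathcal{X}$ if $\mathcal{W}\subseteq\mathcal{X}$ and for each $X\in\mathcal{X}$ there is an exact sequence $0\to X\to W\to X'\to0$ with $W\in\mathcal{W}$, $X'\in\mathcal{X}$; it is an injective cogenerator if moreover $\mathcal{X}\perp\mathcal{W}$. $\mathcal{V}$ is a generator for $\mathcal{Y}$ if $\mathcal{V}\subseteq\mathcal{Y}$ and for each $Y\in\mathcal{Y}$ there is an exact sequence $0\to Y'\to V\to Y\to 0$ with $V\in\mathcal{V}$, $Y'\in\mathcal{Y}$; it is a projective generator if moreover $\mathcal{V}\perp\mathcal{Y}$. Complexes are indexed homologically; for complexes $M,N$, $\operatorname{Hom}_{\mathcal{A}}(M,N)$ is the complex of abelian groups with $\operatorname{Hom}_{\mathcal{A}}(M,N)_n=\prod_p\operatorname{Hom}_{\mathcal{A}}(M_p,N_{p+n})$ and the usual differential. For a subcategory $\mathcal{C}$, a $\mathcal{C}$-resolution of $M$ is a complex $C$ of objects of $\mathcal{C}$ with $C_n=0$ for $n<0$, $\operatorname{H}_n(C)=0$ for $n>0$ and $\operatorname{H}_0(C)\cong M$; its augmented resolution is the exact sequence $C^+=\cdots\to C_1\to C_0\to M\to0$. It is proper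 if $\operatorname{Hom}_{\mathcal{A}}(C',C^+)$ is exact for every $C'\in\mathcal{C}$. $\operatorname{res}\widehat{\mathcal{C}}$ is the subcategory of objects having a bounded $\mathcal{C}$-resolution, $\operatorname{res}\widetilde{\mathcal{C}}$ that of objects having a proper $\mathcal{C}$-resolution. Dually, a $\mathcal{C}$-coresolution of $N$ is a complex $C$ of objects of $\mathcal{C}$ with $C_n=0$ for $n>0$, $\operatorname{H}_n(C)=0$ for $n<0$ and $\operatorname{H}_0(C)\cong N$, with augmented coresolution ${}^+C=0\to N\to C_0\to C_{-1}\to\cdots$; it is proper if $\operatorname{Hom}_{\mathcal{A}}({}^+C,C')$ is exact for every $C'\in\mathcal{C}$. $\operatorname{cores}\widehat{\mathcal{C}}$ (resp. $\operatorname{cores}\widetilde{\mathcal{C}}$) is the subcategory of objects having a bounded (resp. proper) $\mathcal{C}$-coresolution. If $M$ has a proper $\mathcal{C}$-resolution $C\to M$, then $\operatorname{Ext}^n_{\mathcal{C}\mathcal{A}}(M,N)=\operatorname{H}_{-n}(\operatorname{Hom}_{\mathcal{A}}(C,N))$. If $N$ has a proper $\mathcal{C}$-coresolution $N\to C$, then $\operatorname{Ext}^n_{\mathcal{A}\mathcal{C}}(M,N)=\operatorname{H}_{-n}(\operatorname{Hom}_{\mathcal{A}}(M,C))$. These are independent of choices; all (co)resolutions needed here exist under the stated hypotheses. Notation such as $\operatorname{Ext}^{\geq1}_{\mathcal{W}\mathcal{A}}(\operatorname{res}\widehat{\mathcal{W}},\mathcal{V})=0$ means vanishing of $\operatorname{Ext}^n_{\mathcal{W}\mathcal{A}}(T,V)$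 for all $n\geq1$, $T\in\operatorname{res}\widehat{\mathcal{W}}$, $V\in\mathcal{V}$. Given subcategories $\mathcal{X}'\subseteq\operatorname{res}\widetilde{\mathcal{X}}$ and $\mathcal{Y}'\subseteq\operatorname{cores}\widetilde{\mathcal{Y}}$, $\operatorname{Ext}_{\mathcal{X}\mathcal{A}}$ and $\operatorname{Ext}_{\mathcal{A}\mathcal{Y}}$ are balanced on $\mathcal{X}'\times\mathcal{Y}'$ if for all $M\in\mathcal{X}'$, $N\in\mathcal{Y}'$, every proper $\mathcal{X}$-resolution $X\to M$ and every proper $\mathcal{Y}$-coresolution $N\to Y$, the induced morphisms of complexes $\operatorname{Hom}_{\mathcal{A}}(M,Y)\to\operatorname{Hom}_{\mathcal{A}}(X,Y)\leftarrow\operatorname{Hom}_{\mathcal{A}}(X,N)$ are quasiisomorphisms. *)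

(* Defs.v *)
From HB Require Import structures.
From mathcomp Require Import all_boot all_order all_algebra.
From mathcomp Require Import generic_quotient ring_quotient boolp.
From Stdlib Require Import Relation_Operators.

Set Implicit Arguments.
Unset Strict Implicit.
Unset Printing Implicit Defensive.

Import GRing.Theory Quotient.
Local Open Scope ring_scope.
Local Open Scope quotient_scope.

Record preadditive := Preadditive {
  obj :> Type;
  hom : obj -> obj -> zmodType;
  idm : forall X, hom X X;
  hcomp : forall X Y Z, hom Y Z -> hom X Y -> hom X Z;
  compA : forall X Y Z T (h : hom Z T) (g : hom Y Z) (f : hom X Y),
    hcomp h (hcomp g f) = hcomp (hcomp h g) f;
  comp1m : forall X Y (f : hom X Y), hcomp (idm Y) f = f;
  compm1 : forall X Y (f : hom X Y), hcomp f (idm X) = f;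
  compDl : forall X Y Z (g h : hom Y Z) (f : hom X Y),
    hcomp (g + h) f = hcomp g f + hcomp h f;
  compDr : forall X Y Z (h : hom Y Z) (f g : hom X Y),
    hcomp h (f + g) = hcomp h f + hcomp h g
}.

Arguments hom {p} _ _.
Arguments idm {p} _.

Notation "g '\c' f" := (hcomp g f) (at level 40, left associativity).

Section Preadditive.
Variable A : preadditive.
Implicit Types X Y Z S K Q : A.

Definition monomorphism X Y (f : hom X Y) : Prop :=
  forall T (u v : hom T X), f \c u = f \c v -> u = v.

Definition epimorphism X Y (f : hom X Y) : Prop :=
  forall T (u v : hom Y T), u \c f = v \c f -> u = v.

Definition is_iso X Y (f : hom X Y) : Prop :=
  exists g : hom Y X, g \c f = idm X /\ f \c g = idm Y.

Definition isomorphic X Y : Prop := exists f : hom X Y, is_iso f.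

Definition is_kernel K X Y (k : hom K X) (f : hom X Y) : Prop :=
  f \c k = 0 /\
  forall T (t : hom T X), f \c t = 0 -> exists! u : hom T K, k \c u = t.

Definition is_cokernel X Y Q (q : hom Y Q) (f : hom X Y) : Prop :=
  q \c f = 0 /\
  forall T (t : hom Y T), t \c f = 0 -> exists! u : hom Q T, u \c q = t.

Definition is_zero X : Prop := idm X = 0.

Definition is_biproduct X Y S : Prop :=
  exists (i : hom X S) (j : hom Y S) (p : hom S X) (q : hom S Y),
    [/\ p \c i = idm X, q \c j = idm Y, p \c j = 0, q \c i = 0
      & i \c p + j \c q = idm S].

(* im f = ker g: f factors as an epimorphism followed by a kernel of g *)
Definition exact_at X Y Z (f : hom X Y) (g : hom Y Z) : Prop :=
  exists K (k : hom K Y) (e : hom X K),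
    [/\ is_kernel k g, epimorphism e & f = k \c e].

Definition short_exact X Y Z (f : hom X Y) (g : hom Y Z) : Prop :=
  is_kernel f g /\ is_cokernel g f.

End Preadditive.

Record abelian := Abelian {
  abcat :> preadditive;
  zob : abcat;
  zobP : is_zero zob;
  biproductP : forall X Y : abcat, exists S, is_biproduct X Y S;
  kernelP : forall (X Y : abcat) (f : hom X Y),
    exists K (k : hom K X), is_kernel k f;
  cokernelP : forall (X Y : abcat) (f : hom X Y),
    exists Q (q : hom Y Q), is_cokernel q f;
  mono_kernel : forall (X Y : abcat) (f : hom X Y),
    monomorphism f -> exists Z (g : hom Y Z), is_kernel f g;
  epi_cokernel : forall (X Y : abcat) (f : hom X Y),
    epimorphism f -> exists Z (g : hom Z X), is_cokernel f g
}.

Arguments zob {a}.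

Section PreadditiveLemmas.
Variable A : preadditive.
Implicit Types X Y Z : A.

Lemma comp0m X Y Z (f : hom X Y) : (0 : hom Y Z) \c f = 0.
Proof. by apply: (addIr ((0 : hom Y Z) \c f)); rewrite -compDl !add0r. Qed.

Lemma compm0 X Y Z (g : hom Y Z) : g \c (0 : hom X Y) = 0.
Proof. by apply: (addIr (g \c (0 : hom X Y))); rewrite -compDr !add0r. Qed.

Lemma compNl X Y Z (g : hom Y Z) (f : hom X Y) : (- g) \c f = - (g \c f).
Proof. by apply/eqP; rewrite -addr_eq0 -compDl addNr comp0m. Qed.

Lemma compNr X Y Z (g : hom Y Z) (f : hom X Y) : g \c (- f) = - (g \c f).
Proof. by apply/eqP; rewrite -addr_eq0 -compDr addNr compm0. Qed.

Lemma compBl X Y Z (g h : hom Y Z) (f : hom X Y) :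
  (g - h) \c f = g \c f - h \c f.
Proof. by rewrite compDl compNl. Qed.

Lemma compBr X Y Z (h : hom Y Z) (f g : hom X Y) :
  h \c (f - g) = h \c f - h \c g.
Proof. by rewrite compDr compNr. Qed.

Lemma compMnl X Y Z (g : hom Y Z) (f : hom X Y) (n : nat) :
  (g *+ n) \c f = (g \c f) *+ n.
Proof. by elim: n => [|n IH]; rewrite ?mulr0n ?comp0m // !mulrS compDl IH. Qed.

Lemma compMnr X Y Z (g : hom Y Z) (f : hom X Y) (n : nat) :
  g \c (f *+ n) = (g \c f) *+ n.
Proof. by elim: n => [|n IH]; rewrite ?mulr0n ?compm0 // !mulrS compDr IH. Qed.

Lemma compMzl X Y Z (g : hom Y Z) (f : hom X Y) (n : int) :
  (g *~ n) \c f = (g \c f) *~ n.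
Proof.
by case: n => n; rewrite ?NegzE ?mulrNz ?compNl -!pmulrn compMnl.
Qed.

Lemma compMzr X Y Z (g : hom Y Z) (f : hom X Y) (n : int) :
  g \c (f *~ n) = (g \c f) *~ n.
Proof.
by case: n => n; rewrite ?NegzE ?mulrNz ?compNr -!pmulrn compMnr.
Qed.

End PreadditiveLemmas.

Section Yoneda.
Variable A : abelian.

(* a short exact sequence 0 -> D -> mid -> C -> 0 *)
Record ses (C D : A) := Ses {
  ses_mid : A;
  ses_in : hom D ses_mid;
  ses_out : hom ses_mid C;
  ses_exact : short_exact ses_in ses_out
}.

(* An (m+1)-fold extension 0 -> D -> E_m -> ... -> E_0 -> C -> 0, written as the
   Yoneda splice of short exact sequences 0 -> K -> E_0 -> C -> 0 (K the
   image of E_1 -> E_0) and so on. *)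
Fixpoint yext (m : nat) (C D : A) : Type :=
  match m with
  | 0 => ses C D
  | m'.+1 => {K : A & (ses C K * yext m' K D)%type}
  end.

Definition ses_map C D C' D' (c : hom C C') (d : hom D D')
    (E : ses C D) (E' : ses C' D') : Prop :=
  exists e : hom (ses_mid E) (ses_mid E'),
    e \c ses_in E = ses_in E' \c d /\ ses_out E' \c e = c \c ses_out E.

(* existence of a morphism of exact sequences with end components c and d; a
   morphism of exact sequences induces unique maps between the images at which
   the sequences are spliced *)
Fixpoint yext_map (m : nat) (C D C' D' : A) (c : hom C C') (d : hom D D') :
    yext m C D -> yext m C' D' -> Prop :=
  match m with
  | 0 => ses_map c d
  | m'.+1 => fun E E' => exists k : hom (projT1 E) (projT1 E'),
      ses_map c k (projT2 E).1 (projT2 E').1 /\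
      yext_map k d (projT2 E).2 (projT2 E').2
  end.

Definition yext_equiv (m : nat) (C D : A) : yext m C D -> yext m C D -> Prop :=
  clos_refl_sym_trans _ (yext_map (idm C) (idm D)).

(* Ext^{m+1}(C, D) is the group of classes of (m+1)-fold extensions under
   yext_equiv; it is never empty, so it vanishes iff it has only one class. *)
Definition Ext_vanishes (m : nat) (C D : A) : Prop :=
  forall E E' : yext m C D, yext_equiv E E'.

End Yoneda.

Section Subcategories.
Variable A : abelian.
Implicit Types P Q W V : A -> Prop.

(* the class of objects of a full, additive, isomorphism-closed subcategory *)
Definition subcategory P : Prop :=
  [/\ P zob,
      forall X Y S, is_biproduct X Y S -> P X -> P Y -> P S
    & forall X Y, isomorphic X Y -> P X -> P Y].

Definition subclass P Q : Prop := forall X, P X -> Q X.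

Definition extension_closed P : Prop :=
  forall (X Y Z : A) (f : hom X Y) (g : hom Y Z),
    short_exact f g -> P X -> P Z -> P Y.

(* Ext^i(C, D) = 0 for all i = m + 1 >= 1 *)
Definition perp P Q : Prop :=
  forall C D, P C -> Q D -> forall m, Ext_vanishes m C D.

Definition cogenerator W P : Prop :=
  subclass W P /\
  forall X, P X -> exists (T X' : A) (f : hom X T) (g : hom T X'),
    [/\ W T, P X' & short_exact f g].

Definition injective_cogenerator W P : Prop := cogenerator W P /\ perp P W.

Definition generator V P : Prop :=
  subclass V P /\
  forall Y, P Y -> exists (Y' T : A) (f : hom Y' T) (g : hom T Y),
    [/\ V T, P Y' & short_exact f g].

Definition projective_generator V P : Prop := generator V P /\ perp V P.

End Subcategories.

(* d i j is the differential when i = j + 1, and 0 otherwise; giving it for all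
   pairs (i, j) avoids transporting along equations between degrees. *)
Record zcomplex := ZComplex {
  zgrp :> int -> zmodType;
  zdif : forall i j, {additive zgrp i -> zgrp j};
  zdif_shape : forall i j, i <> j + 1 -> forall x, zdif i j x = 0;
  zdif_dif : forall i j k x, zdif j k (zdif i j x) = 0
}.

Record zmap (G H : zcomplex) := ZMap {
  zmap_fun :> forall n, {additive G n -> H n};
  zmap_comm : forall i j x, zmap_fun j (zdif G i j x) = zdif H i j (zmap_fun i x)
}.

Section Homology.
Variables (G : zcomplex) (n : int).

Definition zcycles : pred (G n) := fun x => zdif G n (n - 1) x == 0.

Fact cycles_closed : zmod_closed zcycles.
Proof.
split=> [|x y]; rewrite !unfold_in /zcycles ?raddf0 // => /eqP zx /eqP zy.
by rewrite raddfB zx zy subrr.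
Qed.
HB.instance Definition _ := GRing.isZmodClosed.Build (G n) zcycles cycles_closed.

Record zcycle := Cycle { cval : G n; cvalP : cval \in zcycles }.
HB.instance Definition _ := [isSub for cval].
HB.instance Definition _ := [Choice of zcycle by <:].
HB.instance Definition _ := [SubChoice_isSubZmodule of zcycle by <:].

Lemma cvalB (x y : zcycle) : cval (x - y) = cval x - cval y.
Proof. exact: (raddfB (val : zcycle -> G n)). Qed.

Definition zboundaries : pred zcycle :=
  fun x => `[< exists y : G (n + 1), zdif G (n + 1) n y = cval x >].

Fact boundaries_closed : zmod_closed zboundaries.
Proof.
split=> [|x y].
  by apply/asboolP; exists 0; rewrite !raddf0.
move=> /asboolP[u ux] /asboolP[v vy]; apply/asboolP.
by exists (u - v); rewrite raddfB cvalB ux vy.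
Qed.
HB.instance Definition _ :=
  GRing.isZmodClosed.Build zcycle zboundaries boundaries_closed.

Definition boundaries_zmod : zmodClosed zcycle :=
  GRing.ZmodClosed.clone zcycle zboundaries _.

Definition homology : zmodType := {quot boundaries_zmod}.

Definition hclass (x : zcycle) : homology := \pi_({quot boundaries_zmod}) x.

Definition hrepr (x : homology) : zcycle := @repr zcycle ({quot boundaries_zmod}) x.

Lemma hreprK x : hclass (hrepr x) = x.
Proof. exact: reprK. Qed.

Lemma hclass_eq x y : hclass x = hclass y <->
  exists z : G (n + 1), zdif G (n + 1) n z = cval x - cval y.
Proof.
split=> [/eqP|[z dz]].
  by rewrite -[_ == _]idealrBE => /asboolP[z]; rewrite cvalB; exists z.
apply/eqP; rewrite -[_ == _]idealrBE; apply/asboolP.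
by exists z; rewrite cvalB.
Qed.

End Homology.

Arguments zcycles G n : clear implicits.

Definition acyclic (G : zcomplex) : Prop :=
  forall n (x : homology G n), x = 0.

Section HomologyMap.
Variables (G H : zcomplex) (f : zmap G H) (n : int).

Fact cycle_map_subproof (x : zcycle G n) : f n (cval x) \in zcycles H n.
Proof.
case: x => x /=; rewrite !unfold_in /zcycles => /eqP zx.
by rewrite -zmap_comm zx raddf0.
Qed.

Definition cycle_map (x : zcycle G n) : zcycle H n := Cycle (cycle_map_subproof x).

Definition homology_map (x : homology G n) : homology H n :=
  hclass (cycle_map (hrepr x)).

Lemma homology_map_class (x : zcycle G n) :
  homology_map (hclass x) = hclass (cycle_map x).
Proof.
have /hclass_eq[y dy] := hreprK (hclass x).
by apply/hclass_eq; exists (f (n + 1) y); rewrite -zmap_comm dy raddfB.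
Qed.

End HomologyMap.

Definition quasi_iso (G H : zcomplex) (f : zmap G H) : Prop :=
  forall n, bijective (homology_map f (n := n)).

Definition zmod_isomorphic (G H : zmodType) : Prop :=
  exists f : {additive G -> H}, bijective f.

Section Complexes.
Variable A : abelian.

Record complex := Complex {
  cob :> int -> A;
  dif : forall i j, hom (cob i) (cob j);
  dif_shape : forall i j, i <> j + 1 -> dif i j = 0;
  dif_dif : forall i j k, dif j k \c dif i j = 0
}.

Record cmap (M N : complex) := CMap {
  cmap_fun :> forall n, hom (M n) (N n);
  cmap_comm : forall i j, cmap_fun j \c dif M i j = dif N i j \c cmap_fun i
}.

Definition exact_complex (M : complex) : Prop :=
  forall n, exact_at (dif M (n + 1) n) (dif M n (n - 1)).

Definition bounded (M : complex) : Prop :=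
  exists b : nat, forall n : int, (b < `|n|)%N -> is_zero (M n).

Definition stalk_ob (M : A) (i : int) : A := if i is Posz 0 then M else zob.

Definition stalk (M : A) : complex.
Proof.
refine (@Complex (stalk_ob M) (fun i j => 0) _ _) => // i j k.
exact: compm0.
Defined.

End Complexes.

Section HomComplex.
Variables (A : abelian) (M N : complex A).

(* prod_p Hom(M_p, N_{p+n}), as the families indexed by all pairs (p, q) that
   vanish outside q = p + n *)
Record homdeg (n : int) := HomDeg {
  hval :> forall p q, hom (M p) (N q);
  hval_supp : forall p q, q <> p + n -> hval p q = 0
}.

Lemma homdegP n (f g : homdeg n) : (forall p q, f p q = g p q) -> f = g.
Proof.
case: f g => f fP [g gP] /= fg.
have efg : f = g by apply: functional_extensionality_dep => p;
  apply: functional_extensionality_dep => q; exact: fg.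
by case: g / efg gP fg => gP _; rewrite (Prop_irrelevance fP gP).
Qed.

Section Degree.
Variable n : int.

Definition homdeg0 : homdeg n := @HomDeg n (fun p q => 0) (fun p q _ => erefl).

Definition homdegN (f : homdeg n) : homdeg n.
Proof.
by exists (fun p q => - f p q) => p q /hval_supp ->; rewrite oppr0.
Defined.

Definition homdegD (f g : homdeg n) : homdeg n.
Proof.
exists (fun p q => f p q + g p q) => p q pq.
by rewrite !hval_supp // addr0.
Defined.

HB.instance Definition _ := gen_eqMixin (homdeg n).
HB.instance Definition _ := gen_choiceMixin (homdeg n).

Fact homdeg_addA : associative homdegD.
Proof. by move=> f g h; apply: homdegP => p q; exact: addrA. Qed.
Fact homdeg_addC : commutative homdegD.
Proof. by move=> f g; apply: homdegP => p q; exact: addrC. Qed.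
Fact homdeg_add0 : left_id homdeg0 homdegD.
Proof. by move=> f; apply: homdegP => p q; exact: add0r. Qed.
Fact homdeg_addN : left_inverse homdeg0 homdegN homdegD.
Proof. by move=> f; apply: homdegP => p q; exact: addNr. Qed.

HB.instance Definition _ := GRing.isZmodule.Build (homdeg n)
  homdeg_addA homdeg_addC homdeg_add0 homdeg_addN.

Lemma hvalB (f g : homdeg n) p q : (f - g) p q = f p q - g p q.
Proof. by []. Qed.

End Degree.

(* d f = d_N f - (-1)^i f d_M for f of degree i *)
Definition homdif_val i (f : homdeg i) p q : hom (M p) (N q) :=
  dif N (q + 1) q \c f p (q + 1)
  - (f (p - 1) q \c dif M p (p - 1)) *~ (-1) ^ i.

Definition homdif_fun i j (f : homdeg i) : homdeg j.
Proof.
exists (fun p q => if i == j + 1 then homdif_val f p q else 0) => p q pq.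
case: eqP => // ij; rewrite /homdif_val.
rewrite (@hval_supp _ f p (q + 1)); last first.
  by move=> e; apply: pq; apply: (addIr 1); rewrite e ij addrA.
rewrite (@hval_supp _ f (p - 1) q); last first.
  by move=> e; apply: pq; rewrite e ij [j + 1]addrC addrA subrK.
by rewrite compm0 comp0m mul0rz subr0.
Defined.

Fact homdif_additive i j : zmod_morphism (@homdif_fun i j).
Proof.
move=> f g; apply: homdegP => p q; rewrite hvalB /=.
case: eqP => _; last by rewrite subr0.
rewrite /homdif_val !hvalB compBr compBl mulrzBl !opprB -!addrA.
by congr (_ + _); rewrite addrCA [RHS]addrCA; congr (_ + _); rewrite addrC.
Qed.
HB.instance Definition _ i j :=
  GRing.isZmodMorphism.Build (homdeg i) (homdeg j) (@homdif_fun i j)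
    (@homdif_additive i j).

Fact homdif_shape i j : i <> j + 1 -> forall f, @homdif_fun i j f = 0.
Proof. by move=> /eqP/negPf ij f; apply: homdegP => p q /=; rewrite ij. Qed.

Fact homdif_dif i j k f : @homdif_fun j k (@homdif_fun i j f) = 0.
Proof.
apply: homdegP => p q /=; case: eqP => // jk; rewrite /homdif_val /=.
case: eqP => [ij|_]; last by rewrite compm0 comp0m mul0rz subr0.
rewrite /homdif_val compBr compBl !compA dif_dif comp0m sub0r compMzl compMzr.
rewrite -!compA dif_dif compm0 mul0rz subr0 compA.
have -> : (-1 : int) ^ i = - (-1) ^ j by rewrite ij exprzDr // expr1z mulrN1.
by rewrite mulrNz opprK subrr.
Qed.

Definition homcpx : zcomplex :=
  ZComplex (zgrp := fun n => homdeg n : zmodType)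
    (zdif := fun i j => @homdif_fun i j) homdif_shape homdif_dif.

End HomComplex.

Section HomFunctoriality.
Variable A : abelian.

Section Pre.
Variables (M M' N : complex A) (a : cmap M M').

Definition precomp_fun n (f : homdeg M' N n) : homdeg M N n.
Proof.
by exists (fun p q => f p q \c a p) => p q /hval_supp ->; rewrite comp0m.
Defined.

Fact precomp_additive n : zmod_morphism (@precomp_fun n).
Proof. by move=> f g; apply: homdegP => p q; exact: compBl. Qed.
HB.instance Definition _ n := GRing.isZmodMorphism.Build
  (homdeg M' N n) (homdeg M N n) (@precomp_fun n) (@precomp_additive n).

Fact precomp_comm i j (f : homdeg M' N i) :
  @precomp_fun j (@homdif_fun A M' N i j f)
  = @homdif_fun A M N i j (@precomp_fun i f).
Proof.
apply: homdegP => p q /=; case: eqP => _; last by rewrite comp0m.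
by rewrite /homdif_val /= compBl compMzl -!compA cmap_comm.
Qed.

(* Hom(a, N) : Hom(M', N) -> Hom(M, N) *)
Definition precomp : zmap (homcpx M' N) (homcpx M N) :=
  @ZMap (homcpx M' N) (homcpx M N) (fun n => @precomp_fun n) precomp_comm.
End Pre.

Section Post.
Variables (M N N' : complex A) (b : cmap N N').

Definition postcomp_fun n (f : homdeg M N n) : homdeg M N' n.
Proof.
by exists (fun p q => b q \c f p q) => p q /hval_supp ->; rewrite compm0.
Defined.

Fact postcomp_additive n : zmod_morphism (@postcomp_fun n).
Proof. by move=> f g; apply: homdegP => p q; exact: compBr. Qed.
HB.instance Definition _ n := GRing.isZmodMorphism.Build
  (homdeg M N n) (homdeg M N' n) (@postcomp_fun n) (@postcomp_additive n).

Fact postcomp_comm i j (f : homdeg M N i) :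
  @postcomp_fun j (@homdif_fun A M N i j f)
  = @homdif_fun A M N' i j (@postcomp_fun i f).
Proof.
apply: homdegP => p q /=; case: eqP => _; last by rewrite compm0.
by rewrite /homdif_val /= compBr compMzr !compA cmap_comm.
Qed.

(* Hom(M, b) : Hom(M, N) -> Hom(M, N') *)
Definition postcomp : zmap (homcpx M N) (homcpx M N') :=
  @ZMap (homcpx M N) (homcpx M N') (fun n => @postcomp_fun n) postcomp_comm.
End Post.

End HomFunctoriality.

Section Resolutions.
Variable A : abelian.

Section Augmented.
Variables (C : complex A) (M : A) (e : hom (C 0) M) (ed : e \c dif C 1 0 = 0).

(* ... -> C_1 -> C_0 -> M -> 0, with M in degree -1; the objects C_n for n < 0
   do not appear *)
Definition aug_ob (i : int) : A :=
  match i with Posz n => C n | Negz 0 => M | Negz _ => zob end.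

Definition aug_dif (i j : int) : hom (aug_ob i) (aug_ob j) :=
  match i, j with
  | Posz m, Posz n => dif C m n
  | Posz 0, Negz 0 => e
  | _, _ => 0
  end.

Fact aug_shape i j : i <> j + 1 -> aug_dif i j = 0.
Proof.
by case: i j => [[|m]|m] [n|[|n]] //= ij; apply: dif_shape.
Qed.

Fact aug_dif_dif i j k : aug_dif j k \c aug_dif i j = 0.
Proof.
case: i j k => [[|m]|[|m]] [[|n]|[|n]] [[|p]|[|p]] //=;
  rewrite ?compm0 ?comp0m ?dif_dif //.
  by rewrite dif_shape ?compm0.
by case: m => [|m]; [exact: ed | rewrite dif_shape ?compm0].
Qed.

Definition augmented : complex A := Complex aug_shape aug_dif_dif.

Definition aug_map_fun (n : int) : hom (C n) (stalk M n) :=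
  match n with Posz 0 => e | _ => 0 end.

Fact aug_map_comm i j :
  aug_map_fun j \c dif C i j = dif (stalk M) i j \c aug_map_fun i.
Proof.
rewrite comp0m; case: j => [[|j]|j] /=; rewrite ?comp0m //.
have [->|/eqP i1] := eqVneq i 1; first exact: ed.
by rewrite dif_shape ?compm0.
Qed.

(* the chain map C -> M induced by e *)
Definition aug_map : cmap C (stalk M) := CMap aug_map_comm.

End Augmented.

Section Coaugmented.
Variables (C : complex A) (N : A) (e : hom N (C 0)).
Hypothesis de : dif C 0 (-1) \c e = 0.

(* 0 -> N -> C_0 -> C_{-1} -> ..., with N in degree 1; the objects C_n for n > 0
   do not appear *)
Definition coaug_ob (i : int) : A :=
  match i with
  | Posz 0 => C 0
  | Posz 1 => N
  | Posz _ => zob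
  | Negz n => C (Negz n)
  end.

Definition coaug_dif (i j : int) : hom (coaug_ob i) (coaug_ob j) :=
  match i, j with
  | Posz 0, Negz n => dif C 0 (Negz n)
  | Negz m, Negz n => dif C (Negz m) (Negz n)
  | Posz 1, Posz 0 => e
  | _, _ => 0
  end.

Fact coaug_shape i j : i <> j + 1 -> coaug_dif i j = 0.
Proof.
by case: i j => [[|[|m]]|m] [[|[|n]]|n] //= ij; apply: dif_shape.
Qed.

Fact coaug_dif_dif i j k : coaug_dif j k \c coaug_dif i j = 0.
Proof.
case: i j k => [[|[|m]]|m] [[|[|n]]|n] [[|[|p]]|p] //=;
  rewrite ?compm0 ?comp0m ?dif_dif //.
case: p => [|p]; first exact: de.
by rewrite dif_shape ?comp0m.
Qed.

Definition coaugmented : complex A := Complex coaug_shape coaug_dif_dif.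

Definition coaug_map_fun (n : int) : hom (stalk N n) (C n) :=
  match n with Posz 0 => e | _ => 0 end.

Fact coaug_map_comm i j :
  coaug_map_fun j \c dif (stalk N) i j = dif C i j \c coaug_map_fun i.
Proof.
rewrite compm0; case: i => [[|i]|i] /=; rewrite ?compm0 //.
have [->|/eqP j1] := eqVneq j (-1); first by rewrite de.
by rewrite dif_shape ?comp0m // => e0; apply: j1; rewrite -[j](addrK 1) -e0.
Qed.

(* the chain map N -> C induced by e *)
Definition coaug_map : cmap (stalk N) C := CMap coaug_map_comm.

End Coaugmented.

Record resolution (P : A -> Prop) (M : A) := Resolution {
  res_cpx :> complex A;
  res_in : forall n, P (res_cpx n);
  res_neg : forall n : int, n < 0 -> is_zero (res_cpx n);
  res_aug : hom (res_cpx 0) M;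
  res_augK : res_aug \c dif res_cpx 1 0 = 0;
  res_exact : exact_complex (augmented res_augK)
}.

Record coresolution (P : A -> Prop) (N : A) := Coresolution {
  cores_cpx :> complex A;
  cores_in : forall n, P (cores_cpx n);
  cores_pos : forall n : int, 0 < n -> is_zero (cores_cpx n);
  cores_aug : hom N (cores_cpx 0);
  cores_augK : dif cores_cpx 0 (-1) \c cores_aug = 0;
  cores_exact : exact_complex (coaugmented cores_augK)
}.

Section ProperResolutions.
Variables (P : A -> Prop) (M : A).

Definition res_map (R : resolution P M) : cmap R (stalk M) :=
  aug_map (res_augK R).

Definition cores_map (S : coresolution P M) : cmap (stalk M) S :=
  coaug_map (cores_augK S).

Definition proper_res (R : resolution P M) : Prop :=
  forall C, P C -> acyclic (homcpx (stalk C) (augmented (res_augK R))).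

Definition proper_cores (S : coresolution P M) : Prop :=
  forall C, P C -> acyclic (homcpx (coaugmented (cores_augK S)) (stalk C)).

(* Ext^n_{PA}(M, N) and Ext^n_{AP}(N, M), computed by R and S; these are the
   relative Ext groups when R, resp. S, is proper. They do not depend on the
   choice of R and S, so statements about them are made for all proper ones. *)
Definition ExtPA (R : resolution P M) (N : A) (n : int) : zmodType :=
  homology (homcpx R (stalk N)) (- n).

Definition ExtAP (N : A) (S : coresolution P M) (n : int) : zmodType :=
  homology (homcpx (stalk N) S) (- n).

End ProperResolutions.

Definition res_hat (P : A -> Prop) (M : A) : Prop :=
  exists R : resolution P M, bounded R.

Definition res_tilde (P : A -> Prop) (M : A) : Prop :=
  exists R : resolution P M, proper_res R.

Definition cores_hat (P : A -> Prop) (N : A) : Prop :=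
  exists S : coresolution P N, bounded S.

Definition cores_tilde (P : A -> Prop) (N : A) : Prop :=
  exists S : coresolution P N, proper_cores S.

(* Ext^{>=1}_{PA}(C, D) = 0 and Ext^{>=1}_{AP}(C, D) = 0 *)
Definition ExtPA_vanishes (P C D : A -> Prop) : Prop :=
  forall M N, C M -> D N -> forall R : resolution P M, proper_res R ->
  forall n : int, 1 <= n -> forall x : ExtPA R N n, x = 0.

Definition ExtAP_vanishes (P C D : A -> Prop) : Prop :=
  forall M N, C M -> D N -> forall S : coresolution P N, proper_cores S ->
  forall n : int, 1 <= n -> forall x : ExtAP M S n, x = 0.

Definition balanced (X Y X' Y' : A -> Prop) : Prop :=
  [/\ subclass X' (res_tilde X), subclass Y' (cores_tilde Y)
    & forall M N, X' M -> Y' N ->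
      forall (R : resolution X M) (S : coresolution Y N),
      proper_res R -> proper_cores S ->
        quasi_iso (precomp S (res_map R)) /\
        quasi_iso (postcomp R (cores_map S))].

End Resolutions.

(* Main.v *)
(* Fix Y' in Y. Balance reduces to the exactness of Hom(R^+, Y') for every proper
   X-resolution R of M in res-hat X, and to the dual statement, which is the
   same statement in the opposite category: once it is known, a cochain of
   Hom(R, S) is reduced to an edge of the double complex one diagonal entry at a
   time.

   Write K for the objects with a bounded W-resolution. Since X _|_ W, shifting
   along a W-resolution gives Ext^1(X, K) = 0. By Auslander-Buchweitz, M has an
   approximation 0 -> K -> X_0 -> M -> 0, which is thus X-proper. A map K -> Y'
   lifts to some V -> Y' because Ext^1(K, Y'') = 0; embedding X_0 in W_0, the
   lift K -> V extends to W_0 because Ext_WA^1(W_0/K, V) = 0; hence K -> Y'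
   extends to X_0. Finally a relative Schanuel argument compares the syzygies of
   an arbitrary proper resolution with these objects K.

   Higher Ext enters only through the shift X _|_ K, and its dual. Yoneda classes
   are handled by the predicate [null c E], "the pullback of E along c is zero",
   which is invariant under equivalence and makes the needed parts of the long
   exact sequences explicit. *)
From HB Require Import structures.
From mathcomp Require Import all_boot all_order all_algebra.
From mathcomp Require Import generic_quotient ring_quotient boolp zify.
Require Import Defs.

Set Implicit Arguments.
Unset Strict Implicit.
Unset Printing Implicit Defensive.

Import Order.TTheory GRing.Theory Num.Theory Quotient.
Local Open Scope ring_scope.
Local Open Scope quotient_scope.

(** * Abelian categories and their opposites *)

Section Opposite.

(** Objects and Hom groups are literally those of [A], with composition reversed. A statement about
    the opposite category therefore unfolds to the dual statement about [A], and dual lemmas follow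
    by conversion. *)
Definition opp_preadditive (A : preadditive) : preadditive.
Proof.
refine (@Preadditive A (fun X Y => hom Y X) (fun X => idm X)
  (fun X Y Z g f => f \c g) _ _ _ _ _).
- by move=> *; rewrite compA.
- by move=> *; apply: compm1.
- by move=> *; apply: comp1m.
- by move=> *; apply: compDr.
- by move=> *; apply: compDl.
Defined.

Definition opp_abelian (A : abelian) : abelian.
Proof.
refine (@Abelian (opp_preadditive A) (@zob A) (zobP A) _ _ _ _ _).
- move=> X Y; have [S [i [j [p [q [h1 h2 h3 h4 h5]]]]]] := biproductP X Y.
  by exists S, p, q, i, j; split.
- by move=> X Y f; exact: (cokernelP (f : hom (_ : A) _)).
- by move=> X Y f; exact: (kernelP (f : hom (_ : A) _)).
- by move=> X Y f; exact: (@epi_cokernel A).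
- by move=> X Y f; exact: (@mono_kernel A).
Defined.

End Opposite.

Section Preadditive.
Variable A : preadditive.
Implicit Types X Y Z T : A.

Lemma mono_eq0 X Y T (f : hom X Y) (u : hom T X) :
  monomorphism f -> f \c u = 0 -> u = 0.
Proof. by move=> mf fu; apply: mf; rewrite compm0. Qed.

Lemma monoP X Y (f : hom X Y) :
  (forall T (u : hom T X), f \c u = 0 -> u = 0) -> monomorphism f.
Proof.
move=> H T u v /eqP; rewrite -subr_eq0 -compBr => /eqP/H/eqP.
by rewrite subr_eq0 => /eqP.
Qed.

Lemma mono_comp X Y Z (g : hom Y Z) (f : hom X Y) :
  monomorphism g -> monomorphism f -> monomorphism (g \c f).
Proof. by move=> mg mf T u v; rewrite -!compA => /mg/mf. Qed.

Lemma mono_of_comp X Y Z (g : hom Y Z) (f : hom X Y) :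
  monomorphism (g \c f) -> monomorphism f.
Proof. by move=> m T u v e; apply: m; rewrite -!compA e. Qed.

Lemma mono_id X : monomorphism (idm X).
Proof. by move=> T u v; rewrite !comp1m. Qed.

Lemma zero_source X Y (f : hom X Y) : is_zero X -> f = 0.
Proof. by move=> z; rewrite -[f]compm1 z compm0. Qed.

Lemma zero_target X Y (f : hom X Y) : is_zero Y -> f = 0.
Proof. by move=> z; rewrite -[f]comp1m z comp0m. Qed.

Lemma kernel_mono K X Y (k : hom K X) (f : hom X Y) :
  is_kernel k f -> monomorphism k.
Proof.
move=> [fk H] T u v e.
have [|w [_ uw]] := H T (k \c u); first by rewrite compA fk comp0m.
by rewrite -(uw u) // -(uw v).
Qed.

Lemma kernel_lift K X Y T (k : hom K X) (f : hom X Y) (t : hom T X) :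
  is_kernel k f -> f \c t = 0 -> exists u, k \c u = t.
Proof. by move=> [_ H] /H [u [e _]]; exists u. Qed.

Lemma kernelI K X Y (k : hom K X) (f : hom X Y) : f \c k = 0 ->
  monomorphism k ->
  (forall T (t : hom T X), f \c t = 0 -> exists u, k \c u = t) -> is_kernel k f.
Proof.
move=> fk mk H; split=> // T t /H [u e]; exists u; split=> // v ev.
by apply: mk; rewrite e.
Qed.

Lemma kernel_comp_mono K X Y Z (k : hom K X) (f : hom X Y) (m : hom Y Z) :
  monomorphism m -> is_kernel k (m \c f) <-> is_kernel k f.
Proof.
move=> mm; split=> kf; have mk := kernel_mono kf; apply: kernelI => //.
- by apply: (mono_eq0 mm); rewrite compA; case: kf.
- by move=> T t e; apply: (kernel_lift kf); rewrite -compA e compm0.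
- by rewrite -compA; case: kf => -> _; rewrite compm0.
- by move=> T t; rewrite -compA => /(mono_eq0 mm); apply: kernel_lift.
Qed.

End Preadditive.

Section CoPreadditive.
Variable A : preadditive.
Implicit Types X Y Z T : A.
Let O := opp_preadditive A.

Lemma epi_eq0 X Y T (f : hom X Y) (u : hom Y T) :
  epimorphism f -> u \c f = 0 -> u = 0.
Proof. exact: (@mono_eq0 O). Qed.

Lemma epiP X Y (f : hom X Y) :
  (forall T (u : hom Y T), u \c f = 0 -> u = 0) -> epimorphism f.
Proof. exact: (@monoP O). Qed.

Lemma epi_comp X Y Z (g : hom Y Z) (f : hom X Y) :
  epimorphism g -> epimorphism f -> epimorphism (g \c f).
Proof. by move=> *; apply: (@mono_comp O). Qed.

Lemma epi_of_comp X Y Z (g : hom Y Z) (f : hom X Y) :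
  epimorphism (g \c f) -> epimorphism g.
Proof. exact: (@mono_of_comp O). Qed.

Lemma epi_id X : epimorphism (idm X).
Proof. exact: (@mono_id O). Qed.

Lemma cokernel_epi X Y Q (q : hom Y Q) (f : hom X Y) :
  is_cokernel q f -> epimorphism q.
Proof. exact: (@kernel_mono O). Qed.

Lemma cokernel_desc X Y Q T (q : hom Y Q) (f : hom X Y) (t : hom Y T) :
  is_cokernel q f -> t \c f = 0 -> exists u, u \c q = t.
Proof. exact: (@kernel_lift O). Qed.

Lemma cokernelI X Y Q (q : hom Y Q) (f : hom X Y) : q \c f = 0 ->
  epimorphism q ->
  (forall T (t : hom Y T), t \c f = 0 -> exists u, u \c q = t) ->
  is_cokernel q f.
Proof. exact: (@kernelI O). Qed.

Lemma ses_mono X Y Z (f : hom X Y) (g : hom Y Z) :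
  short_exact f g -> monomorphism f.
Proof. by case=> /kernel_mono. Qed.

Lemma ses_epi X Y Z (f : hom X Y) (g : hom Y Z) :
  short_exact f g -> epimorphism g.
Proof. by case=> _ /cokernel_epi. Qed.

Lemma ses_comp0 X Y Z (f : hom X Y) (g : hom Y Z) :
  short_exact f g -> g \c f = 0.
Proof. by case=> -[]. Qed.

Lemma ses_lift X Y Z T (f : hom X Y) (g : hom Y Z) (t : hom T Y) :
  short_exact f g -> g \c t = 0 -> exists u, f \c u = t.
Proof. by case=> k _; apply: kernel_lift. Qed.

Lemma ses_desc X Y Z T (f : hom X Y) (g : hom Y Z) (t : hom Y T) :
  short_exact f g -> t \c f = 0 -> exists u, u \c g = t.
Proof. by case=> _ k; apply: cokernel_desc. Qed.

Lemma ses_op X Y Z (f : hom X Y) (g : hom Y Z) :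
  short_exact f g -> @short_exact O _ _ _ g f.
Proof. by case. Qed.

Lemma ses_unop X Y Z (f : hom X Y) (g : hom Y Z) :
  @short_exact O _ _ _ g f -> short_exact f g.
Proof. by case. Qed.

Lemma section_retraction X Y Z (f : hom X Y) (g : hom Y Z) :
  short_exact f g -> (exists s, g \c s = idm Z) -> exists r, r \c f = idm X.
Proof.
move=> fg [s gs].
have [|r fr] := ses_lift (t := idm Y - s \c g) fg.
  by rewrite compBr compA gs comp1m compm1 subrr.
exists r; apply: (ses_mono fg).
by rewrite compA fr compBl -compA (ses_comp0 fg) compm0 subr0 comp1m compm1.
Qed.

End CoPreadditive.

(** * Short exact sequences, pullbacks and pushouts in an abelian category *)

Section Abelian.
Variable A : abelian.
Implicit Types X Y Z T : A.

Lemma zob_source X (f : hom (zob : A) X) : f = 0.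
Proof. exact/zero_source/zobP. Qed.

Lemma zob_target X (f : hom X (zob : A)) : f = 0.
Proof. exact/zero_target/zobP. Qed.

(** An epimorphism is the cokernel of some [g]. Since [g] factors through [k], the epimorphism is
    also the cokernel of [k]. *)
Lemma epi_ses K X Y (k : hom K X) (f : hom X Y) :
  epimorphism f -> is_kernel k f -> short_exact k f.
Proof.
move=> ef kf; split=> //.
have [Z [g [fg gu]]] := epi_cokernel ef.
have [w e] := kernel_lift kf fg.
split=> [|T t tk]; first by case: kf.
by apply: gu; rewrite -e compA tk comp0m.
Qed.

Lemma epi_ses_ex X Y (f : hom X Y) :
  epimorphism f -> exists K (k : hom K X), short_exact k f.
Proof.
by move=> ef; have [K [k kf]] := kernelP f; exists K, k; apply: epi_ses.
Qed.

(** The pullback is the kernel of [f \c p - g \c q] on the biproduct. If [f] is epi, so is this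
    difference, which is then the cokernel of its kernel. If [t] vanishes on the projection to [Y],
    then [t \c q] factors through the difference, and restricting to [X] shows that the factor is
    zero. *)
Lemma pullback_ex X Y Z (f : hom X Z) (g : hom Y Z) :
  exists P (x : hom P X) (y : hom P Y),
  [/\ f \c x = g \c y,
      forall T (u : hom T X) (v : hom T Y), f \c u = g \c v ->
        exists w, x \c w = u /\ y \c w = v,
      forall T (w w' : hom T P), x \c w = x \c w' -> y \c w = y \c w' -> w = w'
    & epimorphism f -> epimorphism y].
Proof.
have [S [i [j [p [q [pi qj pj qi ipq]]]]]] := biproductP X Y.
have [P [k kP]] := kernelP (f \c p - g \c q).
have k0 : f \c p \c k = g \c q \c k.
  by apply/eqP; rewrite -subr_eq0 -compBl; case: kP => ->.
exists P, (p \c k), (q \c k); rewrite !compA; split=> //.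
- move=> T u v e.
  have pw : p \c (i \c u + j \c v) = u.
    by rewrite compDr !compA pi pj comp1m comp0m addr0.
  have qw : q \c (i \c u + j \c v) = v.
    by rewrite compDr !compA qi qj comp1m comp0m add0r.
  have [|w kw] := kernel_lift (t := i \c u + j \c v) kP.
    by rewrite compBl -!compA pw qw e subrr.
  by exists w; rewrite -!compA kw.
- move=> T w w' e1 e2; apply: (kernel_mono kP).
  by rewrite -[k]comp1m -ipq !compDl -!compA (compA p) e1 (compA q) e2 !compA.
- move=> ef.
  have eS : epimorphism (f \c p - g \c q).
    apply: (@epi_of_comp _ _ _ _ _ i).
    by rewrite compBl -!compA pi qi compm0 subr0 compm1.
  apply: epiP => T t; rewrite compA => tq0.
  have [w e] := ses_desc (epi_ses eS kP) tq0.
  have w0 : w = 0.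
    apply: (epi_eq0 ef).
    have := congr1 (fun h => h \c i) e.
    by rewrite -!compA compBl -!compA pi qi !compm0 subr0 compm1.
  by rewrite -[t]compm1 -qj compA -e w0 !comp0m.
Qed.

End Abelian.

Section CoAbelian.
Variable A : abelian.
Implicit Types X Y Z T : A.
Let O := opp_abelian A.

Lemma mono_ses X Y Q (f : hom X Y) (q : hom Y Q) :
  monomorphism f -> is_cokernel q f -> short_exact f q.
Proof. by move=> mf qf; apply/ses_unop/(@epi_ses O). Qed.

Lemma mono_ses_ex X Y (f : hom X Y) :
  monomorphism f -> exists Q (q : hom Y Q), short_exact f q.
Proof.
by move=> mf; have [Q [q qf]] := cokernelP f; exists Q, q; apply: mono_ses.
Qed.

Lemma pushout_ex X Y Z (f : hom Z X) (g : hom Z Y) :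
  exists P (x : hom X P) (y : hom Y P),
  [/\ x \c f = y \c g,
      forall T (u : hom X T) (v : hom Y T), u \c f = v \c g ->
        exists w, w \c x = u /\ w \c y = v,
      forall T (w w' : hom P T), w \c x = w' \c x -> w \c y = w' \c y -> w = w'
    & monomorphism f -> monomorphism y].
Proof. exact: (@pullback_ex O). Qed.

Lemma pushout_ses J B C D (i : hom J B) (p : hom B C) (j : hom J D) :
  short_exact i p ->
  exists B' (i' : hom D B') (p' : hom B' C) (h : hom B B'),
  [/\ short_exact i' p', h \c i = i' \c j, p' \c h = p,
      forall T (x : hom B T) (y : hom D T), x \c i = y \c j ->
        exists w, w \c h = x /\ w \c i' = y
    & forall T (w w' : hom B' T),
        w \c h = w' \c h -> w \c i' = w' \c i' -> w = w'].
Proof.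
move=> ip.
have [B' [h [i' [hi univ joint mi]]]] := pushout_ex i j.
have {}mi := mi (ses_mono ip).
have [|p' [p'h p'i]] := univ _ p 0; first by rewrite comp0m (ses_comp0 ip).
exists B', i', p', h; split=> //; apply: mono_ses => //.
have ep : epimorphism p'.
  by apply: (@epi_of_comp _ _ _ _ _ h); rewrite p'h; apply: ses_epi ip.
apply: cokernelI => // T t ti.
have [|u e] := ses_desc (t := t \c h) ip.
  by rewrite -compA hi compA ti comp0m.
exists u; apply: joint; first by rewrite -compA p'h.
by rewrite -compA p'i compm0 ti.
Qed.

End CoAbelian.

Lemma pullback_ses (A : abelian) (J B C D : A) (i : hom J B) (p : hom B C)
    (c : hom D C) :
  short_exact i p ->
  exists B' (i' : hom J B') (p' : hom B' D) (h : hom B' B),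
  [/\ short_exact i' p', p \c h = c \c p', h \c i' = i,
      forall T (x : hom T B) (y : hom T D), p \c x = c \c y ->
        exists w, h \c w = x /\ p' \c w = y
    & forall T (w w' : hom T B'),
        h \c w = h \c w' -> p' \c w = p' \c w' -> w = w'].
Proof.
move=> /ses_op ip.
have [B' [i' [p' [h [s' e1 e2 u j]]]]] := @pushout_ses (opp_abelian A) _ _ _ _ _ _ c ip.
by exists B', p', i', h; split=> //; apply: ses_unop.
Qed.

(** * Yoneda extensions *)

Section YonedaExt.
Variable A : abelian.
Implicit Types C D J K : A.

Lemma ses_map_comp C D C1 D1 C2 D2 (c : hom C C1) (c' : hom C1 C2)
    (d : hom D D1) (d' : hom D1 D2) (E : ses C D) (E1 : ses C1 D1)
    (E2 : ses C2 D2) :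
  ses_map c d E E1 -> ses_map c' d' E1 E2 -> ses_map (c' \c c) (d' \c d) E E2.
Proof.
move=> [e [e1 e2]] [e' [e1' e2']]; exists (e' \c e); split.
  by rewrite -compA e1 compA e1' compA.
by rewrite compA e2' -compA e2 compA.
Qed.

Lemma ses_pushout C J D (b : ses C J) (j : hom J D) :
  exists b' : ses C D, ses_map (idm C) j b b' /\
    forall C1 D1 (a : ses C1 D1) (c : hom C C1) (d : hom D D1),
      ses_map c (d \c j) b a -> ses_map c d b' a.
Proof.
have [B' [i' [p' [h [s' e1 e2 univ joint]]]]] := pushout_ses j (ses_exact b).
exists (Ses s'); split; first by exists h; rewrite /= comp1m.
move=> C1 D1 a c d [x [x1 x2]].
have [|w [w1 w2]] := univ _ x (ses_in a \c d); first by rewrite x1 compA.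
exists w; split=> //; apply: joint; rewrite /= -!compA.
  by rewrite w1 e2.
rewrite w2 (ses_comp0 s') compm0.
by rewrite compA (ses_comp0 (ses_exact a)) comp0m.
Qed.

Lemma ses_pullback C C' D (b : ses C D) (c : hom C' C) :
  exists b' : ses C' D, ses_map c (idm D) b' b.
Proof.
have [B' [i' [p' [h [s' e1 e2 _ _]]]]] := pullback_ses c (ses_exact b).
by exists (Ses s'), h; rewrite /= compm1.
Qed.

(* a map of short exact sequences that is the identity on the left is a pullback *)
Lemma ses_map_lift C C1 D (c : hom C C1) (a : ses C D) (a1 : ses C1 D)
    (t : hom (ses_mid a) (ses_mid a1)) T (u : hom T C) (v : hom T (ses_mid a1)) :
  t \c ses_in a = ses_in a1 -> ses_out a1 \c t = c \c ses_out a ->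
  ses_out a1 \c v = c \c u ->
  exists w, ses_out a \c w = u /\ t \c w = v.
Proof.
move=> t1 t2 vu.
have [P [y [p [e1 _ _ ep]]]] := pullback_ex (ses_out a) u.
have {}ep := ep (ses_epi (ses_exact a)).
have [|z ez] := ses_lift (t := v \c p - t \c y) (ses_exact a1).
  by rewrite compBr !compA t2 vu -!compA e1 subrr.
have [K [k kp]] := epi_ses_ex ep.
(* The lift is first built on the cover [p] of [T]: [y] lifts [u], and the correction by [z] makes
   it agree with [v]. It vanishes on the kernel of [p], so it descends to [T]. *)
pose w' := y + ses_in a \c z.
have w1 : ses_out a \c w' = u \c p.
  by rewrite compDr compA (ses_comp0 (ses_exact a)) comp0m addr0.
have w2 : t \c w' = v \c p by rewrite compDr compA t1 ez addrC subrK.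
have [|w ew] := ses_desc (t := w') kp.
  have [|x ex] := ses_lift (t := w' \c k) (ses_exact a).
    by rewrite compA w1 -compA (ses_comp0 kp) compm0.
  rewrite -ex (_ : x = 0) ?compm0 //.
  apply: (mono_eq0 (ses_mono (ses_exact a1))).
  by rewrite -t1 -compA ex compA w2 -compA (ses_comp0 kp) compm0.
exists w; split; apply: (ses_epi kp).
  by rewrite -compA ew.
by rewrite -compA ew.
Qed.

(* [null c E] expresses that the pullback of the extension class of E along c
   vanishes. *)
Fixpoint null (m : nat) (C D C' : A) (c : hom C' C) : yext m C D -> Prop :=
  match m with
  | 0 => fun E => exists s : hom C' (ses_mid E), ses_out E \c s = c
  | m'.+1 => fun E => exists J (b : ses C' J) (j : hom J (projT1 E)),
      ses_map c j b (projT2 E).1 /\ null j (projT2 E).2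
  end.

Lemma null_comp m C D C1 C2 (c : hom C1 C) (u : hom C2 C1) (E : yext m C D) :
  null c E -> null (c \c u) E.
Proof.
case: m E => [E /= [s <-]|m].
  by exists (s \c u); rewrite compA.
move=> [K [a F]] /= [J [b [j [ab n]]]].
have [b' bb'] := ses_pullback b u.
exists J, b', j; split=> //.
by rewrite -[j]compm1; apply: ses_map_comp bb' ab.
Qed.

Lemma null_map m C D C1 D1 C' (c : hom C C1) (d : hom D D1) (u : hom C' C)
    (E : yext m C D) (E1 : yext m C1 D1) :
  yext_map c d E E1 -> null u E -> null (c \c u) E1.
Proof.
elim: m C D C1 D1 C' c d u E E1 => [|m IH] C D C1 D1 C' c d u.
  move=> E E1 /= [e [_ e2]] [s es]; exists (e \c s).
  by rewrite -es !compA e2.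
move=> [K [a F]] [K1 [a1 F1]] /= [k [ka kF]] [J [b [j [ab n]]]].
by exists J, b, (k \c j); split; [apply: ses_map_comp ab ka | apply: IH kF n].
Qed.

Lemma id_ses (C : A) : short_exact (0 : hom (zob : A) C) (idm C).
Proof.
apply: epi_ses (@epi_id _ C) _; apply: kernelI; first by rewrite compm0.
  by move=> T u v _; rewrite (zob_target u) (zob_target v).
by move=> T t; rewrite comp1m => ->; exists 0; rewrite compm0.
Qed.

Lemma null0 m C D C' (E : yext m C D) : null (0 : hom C' C) E.
Proof.
elim: m C D C' E => [|m IH] C D C'; first by move=> E; exists 0; rewrite compm0.
move=> [K [a F]] /=; exists zob, (Ses (id_ses C')), 0; split; last exact: IH.
by exists 0; rewrite /= !compm0 !comp0m.
Qed.

Lemma null_top m C D C' (E : yext m.+1 C D) (s : hom C' (ses_mid (projT2 E).1)) :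
  null (ses_out (projT2 E).1 \c s) E.
Proof.
exists zob, (Ses (id_ses C')), 0; split; last exact: null0.
by exists s; rewrite /= !compm0 compm1.
Qed.

(** Effaceability: the epimorphism onto [K] in the first short exact sequence of [F] lifts to the
    middle term by the identity. *)
Lemma null_epi m K D (F : yext m K D) :
  exists T (q : hom T K), epimorphism q /\ null q F.
Proof.
case: m F => [F|m F].
  exists (ses_mid F), (ses_out F); split; first exact: ses_epi (ses_exact F).
  by exists (idm _); rewrite compm1.
exists _, (ses_out (projT2 F).1); split.
  exact: ses_epi (ses_exact _).
by rewrite -[ses_out _]compm1; apply: null_top.
Qed.

(** In positive depth the two witnesses are compared on the fibre product of their middle terms over
    [C']. Its kernel over [C'] maps to both [J] and [J'], and induction applies to the difference of
    the induced maps. *)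
Lemma nullB m C D C' (c c' : hom C' C) (E : yext m C D) :
  null c E -> null c' E -> null (c - c') E.
Proof.
elim: m C D C' c c' E => [|m IH] C D C' c c'.
  by move=> E [s <-] [s' <-]; exists (s - s'); rewrite compBr.
move=> [K [a F]] /= [J [b [j [[be [b1 b2]] nj]]]] [J' [b' [j' [[be' [b1' b2']] nj']]]].
have [P [x [y [xy _ _ ey]]]] := pullback_ex (ses_out b) (ses_out b').
have {}ey := ey (ses_epi (ses_exact b)).
have ep : epimorphism (ses_out b' \c y).
  by apply: epi_comp => //; apply: ses_epi (ses_exact b').
have [I [i ip]] := epi_ses_ex ep.
have [|u eu] := ses_lift (t := x \c i) (ses_exact b).
  by rewrite compA xy (ses_comp0 ip).
have [|v ev] := ses_lift (t := y \c i) (ses_exact b').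
  by rewrite compA (ses_comp0 ip).
exists I, (Ses ip), (j \c u - j' \c v); split; last first.
  by apply: IH; apply: null_comp.
exists (be \c x - be' \c y); split => /=.
  by rewrite compBl compBr -!compA -eu -ev !compA b1 b1'.
by rewrite compBr !compA b2 b2' !compBl -!compA xy.
Qed.

(** The converse of [null_map] when the end [D] is fixed. After pulling the witness back to the
    first sequence of [E], the two resulting maps into the first sequence of [E1] differ by a map
    [p] into its kernel [K1]. *)
Lemma null_unmap m C D C1 C' (c : hom C C1) (u : hom C' C)
    (E : yext m C D) (E1 : yext m C1 D) :
  yext_map c (idm D) E E1 -> null (c \c u) E1 -> null u E.
Proof.
elim: m C C1 C' c u E E1 => [|m IH] C C1 C' c u.
  move=> E E1 /= [e []]; rewrite compm1 => e1 e2 [s es].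
  by have [w [w1 w2]] := ses_map_lift e1 e2 es; exists w.
move=> [K [a F]] [K1 [a1 F1]] /= [k [[t [t1 t2]] kF]] [J [b [j [[be [b1 b2]] nj]]]].
have [P [y [x [yx _ _ ex]]]] := pullback_ex (ses_out a) (u \c ses_out b).
have {}ex := ex (ses_epi (ses_exact a)).
have [|p ep] := ses_lift (t := be \c x - t \c y) (ses_exact a1).
  by rewrite compBr !compA b2 t2 -!compA yx -!compA subrr.
(* The map [p] need not be null for [F1]. Refining the cover by the pullback of an epimorphism [q]
   that kills [F1] makes it so. *)
have [T [q [eq nq]]] := null_epi F1.
have [P' [s [r [sr _ _ er]]]] := pullback_ex q p.
have {}er := er eq.
have eB : epimorphism (ses_out b \c x \c r).
  by do 2!apply: epi_comp => //; apply: ses_epi (ses_exact b).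
have [J' [i ir]] := epi_ses_ex eB.
have [|j1 ej1] := ses_lift (t := y \c r \c i) (ses_exact a).
  by rewrite !compA yx -!compA (compA (ses_out b)) (compA _ r) (ses_comp0 ir) compm0.
have [|j2 ej2] := ses_lift (t := x \c r \c i) (ses_exact b).
  by rewrite !compA (ses_comp0 ir).
exists J', (Ses ir), j1; split.
  by exists (y \c r); rewrite ej1 /= !compA yx.
apply: (IH _ _ _ k _ _ F1) kF _.
have -> : k \c j1 = j \c j2 - q \c (s \c i).
  apply: (ses_mono (ses_exact a1)).
  have -> : ses_in a1 \c (k \c j1) = t \c y \c r \c i.
    by rewrite compA -t1 -compA ej1 !compA.
  have ej : ses_in a1 \c (j \c j2) = be \c x \c r \c i.
    by rewrite compA -b1 -compA ej2 !compA.
  by rewrite compBr ej (compA q) sr !compA ep !compBl opprB addrC subrK.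
by apply: nullB; apply: null_comp.
Qed.

(** Equivalence is generated by morphisms in one direction, so both transfer results [null_map] and
    [null_unmap] enter here. *)
Lemma null_equiv m C D (E E' : yext m C D) :
  yext_equiv E E' -> null (idm C) E <-> null (idm C) E'.
Proof.
elim=> {E E'} [E E' h|//|E E' _ [] //|E E' E'' _ [a b] _ [c d]].
- split=> n; first by rewrite -[idm C]comp1m; apply: null_map h n.
  by apply: (null_unmap h); rewrite comp1m.
- by split=> [/a/c|/d/b].
Qed.

Lemma null_ex m C D : exists E : yext m C D, null (idm C) E.
Proof.
elim: m C => [|m IH] C; last first.
  have [F nF] := IH zob.
  exists (existT _ zob (Ses (id_ses C), F)) => /=.
  exists zob, (Ses (id_ses C)), (idm _); split=> //.
  by exists (idm _); rewrite /= !comp1m compm1.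
have [S [i [j [p [q [pi qj pj qi ipq]]]]]] := biproductP D C.
have s : short_exact i q.
  have mi : monomorphism i by apply: (@mono_of_comp _ _ _ _ p); rewrite pi; apply: mono_id.
  have eq : epimorphism q by apply: (@epi_of_comp _ _ _ _ _ j); rewrite qj; apply: epi_id.
  apply: epi_ses => //; apply: kernelI => // T t qt; exists (p \c t).
  by rewrite -[RHS]comp1m -ipq compDl -!compA qt compm0 addr0.
by exists (Ses s), j.
Qed.

Lemma Ext_vanishes_null m C D (E : yext m C D) :
  Ext_vanishes m C D -> null (idm C) E.
Proof.
by move=> H; have [E0 n0] := null_ex m C D; apply/(null_equiv (H E E0)).
Qed.

(** * Dimension shifting for the vanishing of Ext in all positive degrees *)

Definition effaced C D : Prop := forall m (E : yext m C D), null (idm C) E.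

Lemma effaced_perp (P Q : A -> Prop) C D : perp P Q -> P C -> Q D -> effaced C D.
Proof. by move=> H pC qD m E; apply/Ext_vanishes_null/H. Qed.

Lemma effaced_split C D M (f : hom D M) (g : hom M C) :
  effaced C D -> short_exact f g -> exists s, g \c s = idm C.
Proof. by move=> /(_ 0 _) H fg; apply: (H (Ses fg)). Qed.

Fixpoint splice m C K D : yext m C K -> ses K D -> yext m.+1 C D :=
  match m with
  | 0 => fun E s => existT _ K (E, s)
  | m'.+1 => fun E s => existT _ (projT1 E) ((projT2 E).1, splice (projT2 E).2 s)
  end.

(** Exactness of the long exact sequence of [s] at the Ext group of [C'] and [K]: a class with zero
    connecting image lifts to an extension by [ses_mid s]. At the last stage of the witness there is
    a lift [t] to [ses_mid s], along which [b] is pushed out. *)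
Lemma null_splice m C K D C' (u : hom C' C) (E : yext m C K) (s : ses K D) :
  null u (splice E s) ->
  exists E' : yext m C' (ses_mid s), yext_map u (ses_out s) E' E.
Proof.
elim: m C C' u E => [|m IH] C C' u.
  move=> E /= [J [b [j [ab [t et]]]]].
  have [b' [_ univ]] := ses_pushout b t.
  by exists b'; apply: univ; rewrite et.
move=> [L [a F]] /= [J [b [j [ab n]]]].
have [E' h] := IH _ _ _ _ n.
by exists (existT _ J (b, E')), j.
Qed.

(** The splice of [E] with the given sequence is an extension by [D1], hence null. So [E] comes from
    an extension by [D0], which is null as well. *)
Lemma effaced_cokernel C D1 D0 K (f : hom D1 D0) (g : hom D0 K) :
  short_exact f g -> effaced C D0 -> effaced C D1 -> effaced C K.
Proof.
move=> fg H0 H1 m E.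
have [E' h] := null_splice (H1 _ (splice E (Ses fg))).
by rewrite -[idm C]comp1m; apply: null_map h (H0 _ E').
Qed.

(* a map of short exact sequences that is the identity on the right is a
   pushout, so it is epi with the kernel of its left component *)
Lemma ses_map_epi C K D (a : ses K D) (b : ses C (ses_mid a)) (s : ses C K)
    (e : hom (ses_mid b) (ses_mid s)) :
  e \c ses_in b = ses_in s \c ses_out a -> ses_out s \c e = ses_out b ->
  short_exact (ses_in b \c ses_in a) e.
Proof.
move=> e1 e2; apply: epi_ses.
  apply: epiP => T t te.
  have [|w ew] := ses_desc (t := t) (ses_exact s).
    apply: (epi_eq0 (ses_epi (ses_exact a))).
    by rewrite -compA -e1 compA te comp0m.
  rewrite -ew (_ : w = 0) ?comp0m //.
  by apply: (epi_eq0 (ses_epi (ses_exact b))); rewrite -e2 compA ew.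
apply: kernelI.
- by rewrite compA e1 -compA (ses_comp0 (ses_exact a)) compm0.
- by apply: mono_comp; [exact: ses_mono (ses_exact b)|exact: ses_mono (ses_exact a)].
move=> T t et.
have [|v ev] := ses_lift (t := t) (ses_exact b).
  by rewrite -e2 -compA et compm0.
have [|w ew] := ses_lift (t := v) (ses_exact a).
  apply: (mono_eq0 (ses_mono (ses_exact s))).
  by rewrite compA -e1 -compA ev.
by exists w; rewrite -compA ew.
Qed.

(** Exactness in the first variable, in degree one. The pushout of [b] along [l] is an extension of
    [C] by [ses_mid a]. Its middle term maps onto [ses_mid s] with kernel [D], and this extension
    restricts to [a] over [K]. *)
Lemma null_ses_extend C J K D (b : ses C J) (s : ses C K) (j : hom J K)
    (a : ses K D) (l : hom J (ses_mid a)) :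
  ses_map (idm C) j b s -> ses_out a \c l = j ->
  exists a' : ses (ses_mid s) D, ses_map (ses_in s) (idm D) a a'.
Proof.
move=> bs lj; have [b' [_ univ]] := ses_pushout b l.
have [|e [e1 e2]] := univ _ _ s (idm C) (ses_out a); first by rewrite lj.
exists (Ses (ses_map_epi e1 (etrans e2 (comp1m _)))), (ses_in b').
by rewrite /= compm1.
Qed.

(** The same exactness in higher degrees. By induction the tail [F] extends over the middle term of
    the pushout [s1]; the head [a] must then be pushed out along [ses_in s1] before it can be
    extended to [ses_mid s]. *)
Lemma null_extend m C J K D (b : ses C J) (s : ses C K) (j : hom J K)
    (E : yext m K D) :
  ses_map (idm C) j b s -> null j E ->
  exists E' : yext m (ses_mid s) D, yext_map (ses_in s) (idm D) E E'.
Proof.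
elim: m C J K b s j E => [|m IH] C J K b s j.
  by move=> E bs [l lj]; apply: null_ses_extend bs lj.
move=> [L [a F]] bs /= [J1 [b1 [j1 [ab n]]]].
have [s1 [bs1 univ]] := ses_pushout b1 j1.
have [F' mF] := IH _ _ _ _ _ _ _ bs1 n.
have [|g [g1 g2]] := univ _ _ a j (idm L); first by rewrite comp1m.
have [a2 [[h [h1 h2]] _]] := ses_pushout a (ses_in s1).
(* Both maps agree on [L], so their difference descends to [J], where it is a lift of [j] to the
   middle term of [a2]. *)
have [|l el] := ses_desc (t := h \c g - ses_in a2) (ses_exact s1).
  by rewrite compBl -compA g1 compm1 h1 subrr.
have lj : ses_out a2 \c l = j.
  apply: (ses_epi (ses_exact s1)); rewrite -compA el compBr compA h2 comp1m g2.
  by rewrite (ses_comp0 (ses_exact a2)) subr0.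
have [a3 m3] := null_ses_extend bs lj.
exists (existT _ (ses_mid s1) (a3, F')), (ses_in s1); split=> //=.
rewrite -[ses_in s]compm1 -(comp1m (ses_in s1)).
by apply: ses_map_comp m3; exists h; split=> //.
Qed.

Lemma effaced_kernel C K V0 D (f : hom K V0) (g : hom V0 C) :
  short_exact f g -> effaced V0 D -> effaced C D -> effaced K D.
Proof.
move=> fg H0 H1 m E.
have [J [b [j [bs n]]]] := H1 m.+1 (existT _ K (Ses fg, E)).
have [E' mE] := null_extend bs n.
apply: (null_unmap mE); rewrite compm1 -[ses_in _]comp1m.
exact: null_comp (H0 _ E').
Qed.

End YonedaExt.

(** * Extension of maps along relative resolutions *)

(** An augmented resolution indexed by naturals: term 0 is the resolved object and term [n.+1] is
    the resolution in degree [n]. In the opposite category the same data form an augmented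
    coresolution, so one argument serves both sides. *)
Record nseq (A : preadditive) := NSeq {
  nob : nat -> A;
  nd : forall n, hom (nob n.+1) (nob n)
}.

Section Sequences.
Variable A : preadditive.

Definition nexact (s : nseq A) : Prop :=
  epimorphism (nd s 0) /\ forall n, exact_at (nd s n.+1) (nd s n).

Definition nproper (P : A -> Prop) (s : nseq A) : Prop :=
  (forall Q, P Q -> forall u : hom Q (nob s 0), exists v, nd s 0 \c v = u) /\
  forall n Q, P Q -> forall u : hom Q (nob s n.+1), nd s n \c u = 0 ->
    exists v, nd s n.+1 \c v = u.

(** Exactness of Hom(s, D), for [D] in [P], at every term of the resolution itself. *)
Definition nextends (P : A -> Prop) (s : nseq A) : Prop :=
  forall n D, P D -> forall f : hom (nob s n.+1) D, f \c nd s n.+1 = 0 ->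
    exists g, g \c nd s n = f.

(** A resolution with at most [n] terms, cut into short exact sequences. *)
Fixpoint fres (P : A -> Prop) (n : nat) (M : A) : Prop :=
  match n with
  | 0 => is_zero M
  | n'.+1 => exists K T (k : hom K T) (e : hom T M),
      [/\ short_exact k e, P T & fres P n' K]
  end.

Definition ext1_zero (C D : A) : Prop :=
  forall M (f : hom D M) (g : hom M C), short_exact f g ->
    exists s, g \c s = idm C.

Lemma zero_ses (X Y Z : A) (f : hom X Y) (g : hom Y Z) :
  is_zero X -> is_zero Y -> is_zero Z -> short_exact f g.
Proof.
move=> zX zY zZ; split.
  split=> [|T t _]; first exact: zero_target.
  exists 0; split=> [|v _]; last by rewrite (zero_target v).
  by rewrite compm0 (zero_target t).
split=> [|T t _]; first exact: zero_source.
exists 0; split=> [|v _]; last by rewrite (zero_source v).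
by rewrite comp0m (zero_source t).
Qed.

End Sequences.

Section Special.
Variables (A : abelian) (W X : A -> Prop).

(** The Auslander-Buchweitz approximation of [M], with kernel of finite [W]-resolution length. *)
Definition special (M : A) : Prop :=
  exists n K T (k : hom K T) (e : hom T M),
    [/\ short_exact k e, X T & fres W n K].

(** [Z] is a direct summand of the sum of [K] and an object of [X]. *)
Definition stable_retract (Z K : A) : Prop :=
  exists P (a : hom Z K) (b : hom K Z) (s : hom Z P) (t : hom P Z),
    X P /\ b \c a + t \c s = idm Z.

End Special.

Section Ext1.
Variable A : abelian.
Implicit Types C D K M T : A.

Lemma ext1_lift C K T M (k : hom K T) (e : hom T M) (u : hom C M) :
  ext1_zero C K -> short_exact k e -> exists v, e \c v = u.
Proof.
move=> H ke; have [B [i [p [h [ip e1 _ _ _]]]]] := pullback_ses u ke.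
by have [s ps] := H _ _ _ ip; exists (h \c s); rewrite compA e1 -compA ps compm1.
Qed.

Lemma ext1_zero_op C D : ext1_zero C D -> @ext1_zero (opp_abelian A) D C.
Proof.
move=> H M f g /ses_unop fg.
exact: (section_retraction fg (H _ _ _ fg)).
Qed.

End Ext1.

(** * Approximations, syzygies and extension of maps, under hypotheses that also apply to the
    opposite category *)

Section Extension.
Variables (A : abelian) (X Y W V : A -> Prop).
Hypotheses (X0 : X zob) (Xext : extension_closed X) (WX : subclass W X).
Hypothesis Wcog : cogenerator W X.
Hypothesis Vgen : generator V Y.
Hypothesis XW : forall n C K, X C -> fres W n K -> ext1_zero C K.
Hypothesis WY : forall C D, W C -> Y D -> ext1_zero C D.
Hypothesis WV : forall n (K W0 M D : A) (k : hom K W0) (e : hom W0 M),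
  short_exact k e -> W W0 -> fres W n K -> V D ->
  forall f : hom K D, exists g, g \c k = f.

(* Lift K -> D through a generator of Y, extend the lift to W0 by [WV]. *)
Lemma fres_extend n (K W0 M D : A) (k : hom K W0) (e : hom W0 M) :
  (forall D, Y D -> ext1_zero K D) ->
  short_exact k e -> W W0 -> fres W n K -> Y D ->
  forall f : hom K D, exists g, g \c k = f.
Proof.
move=> KY ke w0 wK yD f.
have [_ /(_ _ yD) [D' [T [i [p [vT yD' ip]]]]]] := Vgen.
have [v ev] := ext1_lift f (KY _ yD') ip.
have [g eg] := WV ke w0 wK vT v.
by exists (p \c g); rewrite -compA eg.
Qed.

(** The cover [e] of [K] by [W0] lifts to [v] into the extension. On [K1] this lift takes values in
    [D], and that restriction extends to [W0] by induction through [fres_extend]. Subtracting the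
    extension lets [v] descend to a splitting. *)
Lemma fres_ext1_zero n K D : fres W n K -> Y D -> ext1_zero K D.
Proof.
elim: n K D => [|n IH] K D /=.
  by move=> zK yD M f g _; exists 0; rewrite compm0 -zK.
move=> [K1 [W0 [k [e [ke w0 wK1]]]]] yD M f g fg.
have [v ev] := ext1_lift e (WY w0 yD) fg.
have [|t et] := ses_lift (t := v \c k) fg.
  by rewrite compA ev (ses_comp0 ke).
have [h eh] := fres_extend (fun D yD => IH K1 D wK1 yD) ke w0 wK1 yD t.
have [|s es] := ses_desc (t := v - f \c h) ke.
  by rewrite compBl -compA eh et subrr.
exists s; apply: (ses_epi ke).
by rewrite -compA es compBr ev compA (ses_comp0 fg) comp0m subr0 comp1m.
Qed.

(** Embed [T] in an object [W0] of [W]. The composite from [K] to [W0] is mono, so [fres_extend]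
    applies to it, and the extension is restricted to [T]. *)
Lemma special_extend n (K T M D : A) (k : hom K T) (e : hom T M) :
  short_exact k e -> X T -> fres W n K -> Y D ->
  forall f : hom K D, exists g, g \c k = f.
Proof.
move=> ke xT wK yD f.
have [_ /(_ _ xT) [W0 [X' [i [q [w0 _ iq]]]]]] := Wcog.
have [Q [c kc]] := mono_ses_ex (mono_comp (ses_mono iq) (ses_mono ke)).
have [g eg] := fres_extend (fun D yD => fres_ext1_zero wK yD) kc w0 wK yD f.
by exists (g \c i); rewrite -compA.
Qed.

Lemma fres_special n K : fres W n K -> special W X K.
Proof.
case: n => [zK|n [K1 [T [k [e [ke wT wK]]]]]]; last first.
  by exists n, K1, T, k, e; split=> //; apply: WX.
exists 0%N, zob, zob, 0, 0; split=> //; last exact: zobP.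
by apply: zero_ses => //; apply: zobP.
Qed.

(* Auslander-Buchweitz: given K -> X1 -> M1 and M1 -> X0 -> M, embed X1 in an
   object of W and push out twice. *)
Lemma fresX_special n M : fres X n M -> special W X M.
Proof.
elim: n M => [|n IH] M /=; first exact: (@fres_special 0).
move=> [M1 [T0 [k0 [e0 [ke0 xT0 /IH [l [K [T1 [k1 [e1 [ke1 xT1 wK]]]]]]]]]]].
have [_ /(_ _ xT1) [W1 [X' [i [q [w1 xX' iq]]]]]] := Wcog.
have [K' [i' [p' [h [ip' hi ph _ _]]]]] := pushout_ses e1 iq.
have wK' : short_exact (i \c k1) h.
  exact: (@ses_map_epi _ _ _ _ (Ses ke1) (Ses iq) (Ses ip') h).
have [Q [i2 [p2 [h2 [ip2 hi2 ph2 univ joint]]]]] := pushout_ses k0 ip'.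
have [|r [r1 r2]] := univ _ 0 e0; first by rewrite comp0m (ses_comp0 ke0).
(* [Q] is an extension of [X'] by [T0], hence in [X]. The resolution of [K'] is that of [K] with
   [W1] added in front. *)
exists l.+1, K', Q, h2, r; split; [|exact: Xext ip2 xT0 xX'|by exists K, W1, (i \c k1), h].
apply: mono_ses.
  apply: monoP => T u hu.
  have [|w ew] := ses_lift (t := u) ip'; first by rewrite -ph2 -compA hu compm0.
  rewrite -ew (_ : w = 0) ?compm0 //; apply: (mono_eq0 (ses_mono ke0)).
  by apply: (mono_eq0 (ses_mono ip2)); rewrite compA -hi2 -compA ew.
apply: cokernelI => //.
  by apply: (@epi_of_comp _ _ _ _ _ i2); rewrite r2; apply: ses_epi ke0.
move=> T t th.
have [|w ew] := ses_desc (t := t \c i2) ke0.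
  by rewrite -compA -hi2 compA th comp0m.
by exists w; apply: joint; rewrite -compA ?r1 ?th ?compm0 // r2.
Qed.

(* A relative Schanuel argument: the syzygies of any two X-proper resolutions
   agree up to retracts and objects of X. *)
Lemma stable_step (Z K Z1 R : A) (z : hom Z1 R) (e : hom R Z) :
  special W X K -> stable_retract X Z K -> short_exact z e -> X R ->
  (forall Q, X Q -> forall u : hom Q Z, exists v, e \c v = u) ->
  (forall D, Y D -> forall f : hom Z1 D, exists g, g \c z = f) /\
  exists K1, special W X K1 /\ stable_retract X Z1 K1.
Proof.
move=> [n [K1 [T [k [q [kq xT wK1]]]]]] [P [a [b [s [t [xP E]]]]]] ze xR lift.
have [b' eb] := lift _ xT (b \c q).
have [a' ea] := ext1_lift (a \c e) (XW xR wK1) kq.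
have [t' et] := lift _ xP t.
have [|a1 ea1] := ses_lift (t := a' \c z) kq.
  by rewrite compA ea -compA (ses_comp0 ze) compm0.
have [|b1 eb1] := ses_lift (t := b' \c k) ze.
  by rewrite compA eb -compA (ses_comp0 kq) compm0.
(* The retract identity [E] says that this map dies in [Z]. The resulting [h] exhibits [Z1] as a
   summand of the sum of [K1] and [R]. *)
have [|h eh] := ses_lift (t := idm R - b' \c a' - t' \c s \c e) ze.
  rewrite !compBr !compA eb et -(compA b) ea compA compm1 -addrA -opprD -compDl E.
  by rewrite comp1m subrr.
have E1 : b1 \c a1 + h \c z = idm Z1.
  apply: (ses_mono ze); rewrite compDr !compA eb1 eh -compA ea1 !compBl comp1m.
  by rewrite -(compA (t' \c s)) (ses_comp0 ze) compm0 subr0 compm1 addrC compA subrK.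
split; last first.
  exists K1; split; first exact: fres_special wK1.
  by exists R, a1, b1, z, h.
move=> D yD f.
(* Only the component of [f] through [K1] needs extending; the other one, [f \c h], is already
   defined on [R]. *)
have [g eg] := special_extend kq xT wK1 yD (f \c b1).
exists (g \c a' + f \c h).
by rewrite compDl -!compA -ea1 compA eg -!compA -compDr E1 compm1.
Qed.

(** Induction along the syzygies [Z], the images of the differentials. Each is a stable retract of a
    special object and receives lifts from [X], which is what [stable_step] consumes and reproduces.
    The induction starts with the resolved object itself. *)
Lemma nproper_nextends (s : nseq A) :
  special W X (nob s 0) -> (forall n, X (nob s n.+1)) -> nexact s ->
  nproper X s -> nextends Y s.
Proof.
move=> sM xs [e0 ex] [pr0 pr].
have inv n : exists Z (e : hom (nob s n.+1) Z) (m : hom Z (nob s n)),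
  [/\ nd s n = m \c e, epimorphism e, monomorphism m,
      forall Q, X Q -> forall u : hom Q Z, exists v, e \c v = u
    & (forall D, Y D -> forall f : hom Z D, exists g, g \c m = f) /\
      exists K, special W X K /\ stable_retract X Z K].
  elim: n => [|n [Z [e [m [de ee mm lift [_ [K [sK ZK]]]]]]]].
    exists (nob s 0), (nd s 0), (idm _); split=> //.
    - by rewrite comp1m.
    - exact: mono_id.
    split; first by move=> D _ f; exists f; rewrite compm1.
    exists (nob s 0); split=> //; exists zob, (idm _), (idm _), 0, 0; split=> //.
    by rewrite compm1 compm0 addr0.
  have [Z1 [z [e1 [kz ee1 de1]]]] := ex n.
  have ze : short_exact z e.
    by apply: epi_ses => //; apply/(kernel_comp_mono z e mm); rewrite -de.
  exists Z1, e1, z; split=> //; first exact: ses_mono ze.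
    move=> Q xQ u; have [|v ev] := pr n Q xQ (z \c u).
      by rewrite de -compA (compA e) (ses_comp0 ze) comp0m compm0.
    by exists v; apply: (ses_mono ze); rewrite compA -de1.
  exact: stable_step sK ZK ze (xs n) lift.
move=> n D yD f fd.
have [Z [e [m [de ee mm _ [ext _]]]]] := inv n.
have [Z1 [z [e1 [kz ee1 de1]]]] := ex n.
have ze : short_exact z e.
  by apply: epi_ses => //; apply/(kernel_comp_mono z e mm); rewrite -de.
have [|f' ef] := ses_desc (t := f) ze.
  by apply: (epi_eq0 ee1); rewrite -compA -de1.
by have [g eg] := ext D yD f'; exists g; rewrite de compA eg.
Qed.

End Extension.

Section BoundedSequences.
Variables (A : abelian) (P : A -> Prop).

Lemma nexact_fres (s : nseq A) b :
  nexact s -> (forall n, P (nob s n.+1)) ->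
  (forall n, (b <= n)%N -> is_zero (nob s n.+1)) -> fres P b (nob s 0).
Proof.
move=> [e0 ex] ps zs.
suff H k n Z (e : hom (nob s n.+1) Z) (m : hom Z (nob s n)) : (n + k)%N = b ->
    nd s n = m \c e -> epimorphism e -> monomorphism m -> fres P k Z.
  by apply: (H b 0%N _ (nd s 0) (idm _)) => //; rewrite ?comp1m //; apply: mono_id.
elim: k n Z e m => [|k IH] n Z e m nk de ee mm /=.
  apply: (epi_eq0 ee); rewrite comp1m; apply: zero_source.
  by apply: zs; rewrite -nk addn0.
have [Z1 [z [e1 [kz ee1 de1]]]] := ex n.
have ze : short_exact z e.
  by apply: epi_ses => //; apply/(kernel_comp_mono z e mm); rewrite -de.
exists Z1, (nob s n.+1), z, e; split=> //.
by apply: IH de1 ee1 (ses_mono ze); rewrite addSnnS.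
Qed.

End BoundedSequences.

(** * Proper resolutions built from an approximation *)

Section Build.
Variables (A : abelian) (W P : A -> Prop).
Hypotheses (W0 : W zob) (WP : subclass W P).

(** The state of an iteration: a short exact sequence ending in [M], together with the number of
    [W]-terms that still resolve its kernel. Each later step resolves that kernel by an object of
    [W], or by zero once the count is exhausted. *)
Record fstep (M : A) := FStep {
  fker : A;
  fmid : A;
  fin : hom fker fmid;
  fout : hom fmid M;
  fexact : short_exact fin fout;
  fmidP : P fmid;
  frank : nat;
  fkerP : fres W frank fker
}.

Lemma fnext_ex M (s : fstep M) : exists s' : fstep (fker s),
  if frank s is n.+1 then frank s' = n else frank s' = 0%N /\ is_zero (fmid s').
Proof.
case: s => K T k e ke pT [|n] /= wK; last first.
  have [K1 [T1 [k1 [e1 [ke1 wT1 wK1]]]]] := wK.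
  by exists (FStep ke1 (WP wT1) wK1).
have h : short_exact (0 : hom (zob : A) zob) (0 : hom zob K).
  by apply: zero_ses => //; apply: zobP.
have h0 : fres W 0 zob by apply: zobP.
by exists (FStep h (WP W0) h0); split=> //; apply: zobP.
Qed.

Definition fnext M (s : fstep M) : fstep (fker s) := projT1 (cid (fnext_ex s)).

Lemma fnextP M (s : fstep M) :
  if frank s is n.+1 then frank (fnext s) = n
  else frank (fnext s) = 0%N /\ is_zero (fmid (fnext s)).
Proof. exact: projT2 (cid (fnext_ex s)). Qed.

Variables (M : A) (s0 : fstep M).

Definition fsteps (n : nat) : {M : A & fstep M} :=
  iter n (fun p => existT _ (fker (projT2 p)) (fnext (projT2 p))) (existT _ M s0).

Definition build : nseq A :=
  @NSeq A (fun n => if n is n'.+1 then fmid (projT2 (fsteps n')) else M)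
    (fun n => match n with
     | 0 => fout s0
     | n'.+1 => fin (projT2 (fsteps n')) \c fout (projT2 (fsteps n'.+1))
     end).

Lemma build_mid n : P (nob build n.+1).
Proof. exact: fmidP. Qed.

Lemma build_kernel n : is_kernel (fin (projT2 (fsteps n))) (nd build n).
Proof.
case: n => [|n]; first by case: (fexact s0).
apply/kernel_comp_mono; first exact: ses_mono (fexact (projT2 (fsteps n))).
by case: (fexact (projT2 (fsteps n.+1))).
Qed.

Lemma build_exact : nexact build.
Proof.
split; first exact: ses_epi (fexact s0).
move=> n; exists (fker (projT2 (fsteps n))), (fin (projT2 (fsteps n))).
exists (fout (projT2 (fsteps n.+1))); split=> //; first exact: build_kernel.
exact: ses_epi (fexact (projT2 (fsteps n.+1))).
Qed.

(** All syzygies have finite [W]-resolutions, so Ext^1 from objects of [P] to them vanishes and maps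
    lift at every stage. *)
Lemma build_proper :
  (forall n Q K, P Q -> fres W n K -> ext1_zero Q K) -> nproper P build.
Proof.
move=> PW; split=> [Q pQ u|n Q pQ u du].
  exact: ext1_lift (PW _ _ _ pQ (fkerP s0)) (fexact s0).
have [w ew] := kernel_lift (build_kernel n) du.
have [v ev] := ext1_lift w (PW _ _ _ pQ (fkerP (projT2 (fsteps n.+1))))
  (fexact (projT2 (fsteps n.+1))).
by exists v; rewrite -ew -ev compA.
Qed.

Lemma build_bounded n : (frank s0 < n)%N -> is_zero (nob build n.+1).
Proof.
have rk i : frank (projT2 (fsteps i)) = (frank s0 - i)%N.
  elim: i => [|i IH]; first by rewrite subn0.
  have := fnextP (projT2 (fsteps i)); rewrite IH.
  change (frank (projT2 (fsteps i.+1))) with (frank (fnext (projT2 (fsteps i)))).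
  by rewrite subnS; case: (frank s0 - i)%N => [[]|k].
case: n => // n hn; have := fnextP (projT2 (fsteps n)).
by rewrite rk (eqP (_ : (frank s0 - n)%N == 0%N)) ?subn_eq0 // => -[].
Qed.

End Build.

(** * Hom complexes *)

Lemma zdif_cval (G : zcomplex) n (x : zcycle G n) : zdif G n (n - 1) (cval x) = 0.
Proof. by have /eqP := cvalP x. Qed.

Lemma hclassB (G : zcomplex) n (x y : zcycle G n) : hclass (x - y) = hclass x - hclass y.
Proof. exact: (raddfB (\pi_({quot boundaries_zmod G n}))). Qed.

Section HomologyFacts.
Variables (G H : zcomplex).

Lemma homology_eq0 n :
  (forall x : homology G n, x = 0) <->
  forall y : G n, zdif G n (n - 1) y = 0 ->
    exists z : G (n + 1), zdif G (n + 1) n z = y.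
Proof.
have h0 : hclass (0 : zcycle G n) = 0 by rewrite -(subrr (0 : zcycle G n)) hclassB subrr.
split=> [h y dy|h x].
  have zy : y \in zcycles G n by rewrite unfold_in /zcycles dy.
  have /hclass_eq[z ez] : hclass (Cycle zy) = hclass 0 by rewrite h0; apply: h.
  by exists z; rewrite ez subr0.
rewrite -[x]hreprK -h0; apply/hclass_eq; rewrite subr0; apply: h.
exact: zdif_cval.
Qed.

Variable f : zmap G H.

Lemma homology_map_additive n : zmod_morphism (homology_map f (n := n)).
Proof.
move=> x y; rewrite -[x]hreprK -[y]hreprK -hclassB !homology_map_class -hclassB.
congr hclass; apply: val_inj; apply: etrans (esym (cvalB _ _)).
by rewrite -[val _]/(f n (cval _)) cvalB raddfB.
Qed.

Lemma quasi_isoI :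
  (forall n (y : G n), zdif G n (n - 1) y = 0 ->
     (exists z, zdif H (n + 1) n z = f n y) ->
     exists w, zdif G (n + 1) n w = y) ->
  (forall n (y : H n), zdif H n (n - 1) y = 0 ->
     exists x : G n, zdif G n (n - 1) x = 0 /\
       exists z, zdif H (n + 1) n z = y - f n x) ->
  quasi_iso f.
Proof.
move=> inj surj n.
have finj : injective (homology_map f (n := n)).
  move=> x x' /hclass_eq[z ez]; rewrite -[x]hreprK -[x']hreprK.
  apply/hclass_eq; apply: inj; last by exists z; rewrite ez raddfB.
  by rewrite raddfB !zdif_cval subrr.
have fsurj y : exists x, homology_map f (n := n) x = y.
  have [x [dx [z ez]]] := surj n _ (zdif_cval (hrepr y)).
  have zx : x \in zcycles G n by rewrite unfold_in /zcycles dx.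
  exists (hclass (Cycle zx)); rewrite homology_map_class -[y]hreprK.
  by apply/esym/hclass_eq; exists z.
exists (fun y => projT1 (cid (fsurj y))) => [x|y].
  exact: finj (projT2 (cid (fsurj (homology_map f x)))).
exact: projT2 (cid (fsurj y)).
Qed.

End HomologyFacts.

Lemma zmod_isomorphicI (G H K : zmodType) (f : G -> K) (g : H -> K) :
  zmod_morphism f -> bijective f -> zmod_morphism g -> bijective g ->
  zmod_isomorphic G H.
Proof.
move=> fB [f' fK f'K] gB [g' gK g'K].
pose h := g' \o f.
have hB : zmod_morphism h.
  by move=> x y; apply: (can_inj gK); rewrite gB /h /= !g'K fB.
pose hH := GRing.isZmodMorphism.Build G H h hB.
pose ha : {additive G -> H} := HB.pack h hH.
exists ha; exists (f' \o g) => [x|y]; rewrite /= /h /=; first by rewrite g'K fK.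
by rewrite f'K gK.
Qed.

Lemma sign_square (i : int) : (-1 : int) ^ i * (-1) ^ i = 1.
Proof. by rewrite -exprzMl // mulrNN mulr1 exp1rz. Qed.

Lemma mulrz_sign (G : zmodType) (x : G) (i : int) : x *~ (-1) ^ i *~ (-1) ^ i = x.
Proof. by rewrite -mulrzA sign_square. Qed.

Section HomComplexes.
Variable A : abelian.
Implicit Types M N : complex A.

(** Cochains with one prescribed entry are the corrections used below. The transports in [v]
    disappear because equality of integers is decidable. *)
Lemma homdeg_single M N n p0 q0 (g : hom (M p0) (N q0)) : q0 = p0 + n ->
  exists phi : homdeg M N n, phi p0 q0 = g /\
    forall p q, p <> p0 \/ q <> q0 -> phi p q = 0.
Proof.
move=> e0.
pose v p q : hom (M p) (N q) :=
  match p0 =P p, q0 =P q with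
  | ReflectT E, ReflectT E' =>
      eq_rect p0 (fun p => hom (M p) (N q)) (eq_rect q0 (fun q => hom (M p0) (N q)) g q E') p E
  | _, _ => 0
  end.
have v0 p q : p <> p0 \/ q <> q0 -> v p q = 0.
  by rewrite /v; case: eqP => // E; case: eqP => // E' [] h; case: h.
have vs p q : q <> p + n -> v p q = 0.
  by move=> h; apply: v0; case: (p =P p0) => [E|]; [right; rewrite e0 -E|left].
exists (HomDeg vs); split=> //=; rewrite /v.
by case: eqP => // E; case: eqP => // E'; rewrite (eq_axiomK E) (eq_axiomK E').
Qed.

Lemma homdif_valE M N i (f : homdeg M N i) p q p' q' : p = p' + 1 -> q' = q + 1 ->
  homdif_val f p q = dif N q' q \c f p q' - (f p' q \c dif M p p') *~ (-1) ^ i.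
Proof. by move=> -> ->; rewrite /homdif_val addrK. Qed.

Lemma homdifE M N i j (f : homdeg M N i) p q p' q' :
  i = j + 1 -> p = p' + 1 -> q' = q + 1 ->
  homdif_fun j f p q = dif N q' q \c f p q' - (f p' q \c dif M p p') *~ (-1) ^ i.
Proof. by move=> ij pp qq /=; case: eqP => // _; apply: homdif_valE. Qed.

Lemma stalk_zero (Q : A) (p : int) : p <> 0 -> is_zero (stalk Q p).
Proof. by case: p => [[|p]|p] // _; apply: zobP. Qed.

(** The three degrees are separate variables tied by equations, so that concrete integers can be
    substituted without transporting morphisms. *)
Lemma homology_stalk_left Q M (i j k : int) : i = j + 1 -> j = k + 1 ->
  (forall x : homology (homcpx (stalk Q) M) j, x = 0) <->
  forall u : hom Q (M j), dif M j k \c u = 0 -> exists v, dif M i j \c v = u.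
Proof.
move=> ij jk; rewrite homology_eq0; have jk1 : j - 1 = k by rewrite jk addrK.
rewrite jk1 -ij; split=> [H u du|H phi dphi].
  have [|phi [phiE phi0]] := @homdeg_single (stalk Q) M j 0 j u; first by rewrite add0r.
  have [|z ez] := H phi.
    apply: homdegP => p q.
    rewrite [LHS](@homdifE _ _ _ _ _ _ _ (p - 1) (q + 1)) ?subrK //.
    rewrite [dif (stalk Q) _ _]/= compm0 mul0rz subr0.
    case: (p =P 0) => [->|/stalk_zero z]; last exact: (zero_source _ (z Q)).
    case: (q + 1 =P j) => [E|h]; last by rewrite phi0 ?compm0 //; right.
    have -> : q = k by apply: (addIr 1); rewrite E.
    by rewrite -jk phiE du.
  exists (z 0 i); rewrite -phiE -ez.
  rewrite (@homdifE _ _ _ _ _ _ _ (-1) i) //.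
  by rewrite /= compm0 mul0rz subr0.
have du : dif M j k \c phi 0 j = 0.
  have := congr1 (fun h : homdeg _ _ k => h 0 k) dphi.
  rewrite [LHS](@homdifE _ _ _ _ _ _ _ (-1) j) //.
  by rewrite /= compm0 mul0rz subr0.
have [v ev] := H _ du.
have [|psi [psiE psi0]] := @homdeg_single (stalk Q) M i 0 i v; first by rewrite add0r.
exists psi; apply: homdegP => p q.
case: (p =P 0) => [->|/stalk_zero z]; last first.
  exact: etrans (zero_source _ (z Q)) (esym (zero_source _ (z Q))).
case: (q =P j) => [->|h]; last by rewrite !hval_supp ?add0r.
rewrite [LHS](@homdifE _ _ _ _ _ _ _ (-1) i) //.
by rewrite /= compm0 mul0rz subr0 psiE.
Qed.

Lemma homology_stalk_right Q M (i j k : int) : i = j + 1 -> j = k + 1 ->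
  (forall x : homology (homcpx M (stalk Q)) (- j), x = 0) <->
  forall u : hom (M j) Q, u \c dif M i j = 0 -> exists v, v \c dif M j k = u.
Proof.
move=> ij jk; rewrite homology_eq0.
have -> : - j - 1 = - i by rewrite ij opprD.
have -> : - j + 1 = - k by rewrite jk opprD subrK.
have ij' : - j = - i + 1 by rewrite ij opprD subrK.
have jk' : - k = - j + 1 by rewrite jk opprD subrK.
split=> [H u du|H phi dphi].
  have [|phi [phiE phi0]] := @homdeg_single M (stalk Q) (- j) j 0 u; first by rewrite subrr.
  have [|z ez] := H phi.
    apply: homdegP => p q.
    rewrite [LHS](@homdifE _ _ _ _ _ _ _ (p - 1) (q + 1)) ?subrK //.
    rewrite comp0m sub0r.
    case: (p - 1 =P j) => [E|h]; last by rewrite phi0 ?comp0m ?mul0rz ?oppr0 //; left.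
    case: (q =P 0) => [->|/stalk_zero z]; last exact: (zero_target _ (z Q)).
    have pi : p = i by rewrite ij -E subrK.
    by rewrite E phiE pi du mul0rz oppr0.
  (* The differential of Hom(M, Q) is precomposition up to a sign, which this factor cancels. *)
  exists (- (z k 0 *~ (-1) ^ (- k))); rewrite -phiE -ez.
  rewrite (@homdifE _ _ _ _ _ _ _ k 1) //.
  by rewrite /= comp0m sub0r compNl compMzl.
have du : phi j 0 \c dif M i j = 0.
  have := congr1 (fun h : homdeg _ _ (- i) => h i 0) dphi.
  rewrite [LHS](@homdifE _ _ _ _ _ _ _ j 1) //.
  rewrite /= comp0m sub0r => /eqP; rewrite oppr_eq0 => /eqP E.
  by rewrite -[LHS](mulrz_sign _ (- j)) E mul0rz.
have [v ev] := H _ du.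
have [|psi [psiE psi0]] := @homdeg_single M (stalk Q) (- k) k 0 (- (v *~ (-1) ^ (- k))).
  by rewrite subrr.
exists psi; apply: homdegP => p q.
case: (q =P 0) => [->|/stalk_zero z]; last first.
  exact: etrans (zero_target _ (z Q)) (esym (zero_target _ (z Q))).
case: (p =P j) => [->|h]; last first.
  rewrite !(@hval_supp _ _ _ _ _ p 0) // => E; apply: h;
    by apply/eqP; rewrite -subr_eq0 -E.
rewrite [LHS](@homdifE _ _ _ _ _ _ _ k 1) //.
by rewrite /= comp0m sub0r psiE compNl mulNrz opprK compMzl mulrz_sign ev.
Qed.

Lemma acyclic_stalk_left Q M : acyclic (homcpx (stalk Q) M) <->
  forall i j k : int, i = j + 1 -> j = k + 1 ->
  forall u : hom Q (M j), dif M j k \c u = 0 -> exists v, dif M i j \c v = u.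
Proof.
split=> [H i j k ij jk|H n]; first exact/(homology_stalk_left Q M ij jk)/H.
have n1 : n = n - 1 + 1 by rewrite subrK.
exact/(homology_stalk_left Q M erefl n1)/H.
Qed.

Lemma acyclic_stalk_right Q M : acyclic (homcpx M (stalk Q)) <->
  forall i j k : int, i = j + 1 -> j = k + 1 ->
  forall u : hom (M j) Q, u \c dif M i j = 0 -> exists v, v \c dif M j k = u.
Proof.
split=> [H i j k ij jk|H n]; first exact/(homology_stalk_right Q M ij jk)/H.
have n1 : - n = - n - 1 + 1 by rewrite subrK.
by rewrite -(opprK n); apply/(homology_stalk_right Q M erefl n1)/H.
Qed.

End HomComplexes.

Lemma homdif_subK (A : abelian) (M N : complex A) (i j k : int)
    (f : homdeg M N j) (g : homdeg M N i) :
  homdif_fun k (f - homdif_fun j g) = homdif_fun k f.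
Proof. by rewrite homdif_additive homdif_dif subr0. Qed.

Lemma precomp_aug_inj (A : abelian) (R S : complex A) (M : A) (e : hom (R 0) M)
    (ed : e \c dif R 1 0 = 0) n (psi psi' : homdeg (stalk M) S n) :
  epimorphism e ->
  precomp_fun (aug_map ed) psi = precomp_fun (aug_map ed) psi' -> psi = psi'.
Proof.
move=> ee E; apply: homdegP => p q.
case: (p =P 0) => [->|/stalk_zero z]; last first.
  exact: etrans (zero_source _ (z A M)) (esym (zero_source _ (z A M))).
by apply: ee; have := congr1 (fun h : homdeg R S n => h 0 q) E.
Qed.

Lemma postcomp_coaug_inj (A : abelian) (R S : complex A) (N : A)
    (e : hom N (S 0)) (de : dif S 0 (-1) \c e = 0) n
    (psi psi' : homdeg R (stalk N) n) :
  monomorphism e ->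
  postcomp_fun (coaug_map de) psi = postcomp_fun (coaug_map de) psi' -> psi = psi'.
Proof.
move=> me E; apply: homdegP => p q.
case: (q =P 0) => [->|/stalk_zero z]; last first.
  exact: etrans (zero_target _ (z A N)) (esym (zero_target _ (z A N))).
by apply: me; have := congr1 (fun h : homdeg R S n => h p 0) E.
Qed.

(** * Reducing a cochain of Hom(R, S) to an edge of the double complex *)

Section Reduction.
Variables (A : abelian) (R S : complex A).
Hypothesis Rneg : forall n : int, n < 0 -> is_zero (R n).
Hypothesis Spos : forall n : int, 0 < n -> is_zero (S n).

(** A nonzero entry needs [p >= 0] and [q = p + n <= 0]. Each cochain thus has finitely many, and
    the reductions terminate. *)
Lemma homdeg_bounded n (phi : homdeg R S n) (p q : int) :
  (Posz `|n| < p) || (q < - Posz `|n|) -> phi p q = 0.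
Proof.
move=> h; case: (q =P p + n) => [E|]; last exact: hval_supp.
case: (ltP p 0) => [/Rneg z|p0]; first exact: zero_source.
case: (ltP 0 q) => [/Spos z|q0]; first exact: zero_target.
exfalso; lia.
Qed.

Section Left.
Variables (M : A) (e : hom (R 0) M) (ed : e \c dif R 1 0 = 0).
Hypothesis ee : epimorphism e.
Hypothesis extS : forall (k : nat) (q : int) (f : hom (R k.+1) (S q)),
  f \c dif R k.+2 k.+1 = 0 -> exists g, g \c dif R k.+1 k = f.
Hypothesis ext0 : forall (q : int) (f : hom (R 0) (S q)),
  f \c dif R 1 0 = 0 -> exists g, g \c e = f.

(* Killing the component of highest R-degree of a cochain one boundary at a
   time leaves only the component on R_0, which then factors through M. *)
Lemma reduce_left (n j : int) (k : nat) (phi : homdeg R S n) :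
  n = j + 1 -> (forall p q : int, Posz k < p -> phi p q = 0) ->
  (forall p q : int, 0 < p -> homdif_fun j phi p q = 0) ->
  exists (gamma : homdeg R S (n + 1)) (psi : homdeg (stalk M) S n),
    phi - homdif_fun n gamma = precomp_fun (aug_map ed) psi.
Proof.
move=> nj; elim: k phi => [|k IH] phi phi0 dphi.
  have [|g eg] := ext0 (f := phi 0 n).
    have := dphi 1 n isT.
    rewrite (@homdifE _ _ _ _ _ _ _ _ 0 (n + 1)) // phi0 // compm0 sub0r => /eqP.
    rewrite oppr_eq0 => /eqP E.
    by rewrite -[LHS](mulrz_sign _ n) E mul0rz.
  have [|psi [psiE _]] := @homdeg_single A (stalk M) S n 0 n g.
    by rewrite add0r.
  exists 0, psi; rewrite raddf0 subr0; apply: homdegP => p q /=.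
  case: (q =P p + n) => [->|h]; last by rewrite !hval_supp // comp0m.
  case: p => [[|p]|p].
  - by rewrite add0r psiE.
  - by rewrite compm0 phi0.
  - have z : is_zero (R (Negz p)) by apply: Rneg.
    exact: etrans (zero_source _ z) (esym (zero_source _ z)).
pose q0 : int := k.+1%:Z + n.
have [|g eg] := extS (f := phi k.+1 q0).
  have := dphi k.+2 q0 isT.
  rewrite (@homdifE _ _ _ _ _ _ _ _ k.+1 (q0 + 1)) //; last by lia.
  rewrite phi0 //; last by lia.
  rewrite compm0 sub0r => /eqP; rewrite oppr_eq0 => /eqP E.
  by rewrite -[LHS](mulrz_sign _ n) E mul0rz.
(* The boundary of [gam] meets only two entries: at [(k.+1, q0)] the sign makes it equal to [phi],
   and at [(k, q0 - 1)] it changes an entry left for the next stage. *)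
have [|gam [gamE gam0]] := @homdeg_single A R S (n + 1) k q0
    (- (g *~ (-1) ^ (n + 1))).
  by rewrite /q0; lia.
have [||gam' [psi E]] := IH (phi - homdif_fun n gam).
- move=> p q kp; rewrite hvalB.
  rewrite (@homdifE _ _ _ _ _ _ _ _ (p - 1) (q + 1)) ?subrK //.
  rewrite (gam0 p); last by left; lia.
  rewrite compm0 sub0r opprK.
  case: (p =P k.+1%:Z) => [->|h]; last first.
    rewrite phi0; last by lia.
    by rewrite gam0 ?comp0m ?mul0rz ?addr0 //; left; lia.
  case: (q =P q0) => [->|h]; last first.
    by rewrite hval_supp // gam0 ?comp0m ?mul0rz ?addr0 //; right.
  have -> : k.+1%:Z - 1 = k by lia.
  by rewrite gamE compNl mulNrz compMzl mulrz_sign eg subrr.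
- by move=> p q p0; rewrite homdif_subK; apply: dphi.
by exists (gam + gam'), psi; rewrite [homdif_fun n _](raddfD (homdif_fun n)) opprD addrA.
Qed.

(** For surjectivity [reduce_left] is applied to a cocycle. For injectivity it is applied to a
    cochain whose boundary comes from [M], hence is zero in positive [R]-degrees; this is why
    [reduce_left] asks for no more than that. *)
Lemma precomp_quasi_iso : quasi_iso (precomp S (aug_map ed)).
Proof.
apply: quasi_isoI => n.
- move=> psi dpsi [phi ephi].
  have [||gam [psi' E]] := @reduce_left (n + 1) n `|(n + 1)%R|%N phi erefl.
  + by move=> p q h; apply: homdeg_bounded; rewrite h.
  + move=> p q p0; have -> : homdif_fun n phi = precomp_fun (aug_map ed) psi by [].
    by rewrite /= ; case: p p0 => [[|p]|p] //= _; rewrite compm0.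
  exists psi'; apply: (precomp_aug_inj ee (ed := ed)).
  rewrite [LHS]precomp_comm -E homdif_subK; exact: ephi.
- move=> phi dphi.
  have n1 : n = n - 1 + 1 by rewrite subrK.
  have [||gam [psi E]] := @reduce_left n (n - 1) `|n|%N phi n1.
  + by move=> p q h; apply: homdeg_bounded; rewrite h.
  + by move=> p q _; have -> : homdif_fun (n - 1) phi = 0 by [].
  have E' : homdif_fun n gam = phi - precomp_fun (aug_map ed) psi.
    by rewrite -E subKr.
  exists psi; split; last by exists gam.
  apply: (precomp_aug_inj ee (ed := ed)); rewrite [LHS]precomp_comm -E homdif_subK.
  by rewrite [LHS]dphi; apply: homdegP => p q; rewrite /= comp0m.
Qed.

End Left.

Section Right.
Variables (N : A) (e : hom N (S 0)) (de : dif S 0 (-1) \c e = 0).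
Hypothesis me : monomorphism e.
Hypothesis liftR : forall (k : nat) (p : int) (f : hom (R p) (S (- k.+1%:Z))),
  dif S (- k.+1%:Z) (- k.+2%:Z) \c f = 0 ->
  exists g, dif S (- k%:Z) (- k.+1%:Z) \c g = f.
Hypothesis lift0 : forall (p : int) (f : hom (R p) (S 0)),
  dif S 0 (-1) \c f = 0 -> exists g, e \c g = f.

(** The mirror image of [reduce_left]: entries are removed from the lowest [S]-degree upwards, and
    the remaining one on [S 0] factors through [N]. Postcomposition carries no sign, so [g] is used
    as it is. *)
Lemma reduce_right (n j : int) (k : nat) (phi : homdeg R S n) :
  n = j + 1 -> (forall p q : int, q < - Posz k -> phi p q = 0) ->
  (forall p q : int, q < 0 -> homdif_fun j phi p q = 0) ->
  exists (gamma : homdeg R S (n + 1)) (psi : homdeg R (stalk N) n),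
    phi - homdif_fun n gamma = postcomp_fun (coaug_map de) psi.
Proof.
move=> nj; elim: k phi => [|k IH] phi phi0 dphi.
  have [|g eg] := lift0 (f := phi (- n) 0).
    have := dphi (- n) (-1) isT.
    rewrite (@homdifE _ _ _ _ _ _ _ _ (- n - 1) 0) ?subrK // (phi0 _ (-1)) //.
    by rewrite comp0m mul0rz subr0.
  have [|psi [psiE _]] := @homdeg_single A R (stalk N) n (- n) 0 g.
    by rewrite addNr.
  exists 0, psi; rewrite raddf0 subr0; apply: homdegP => p q /=.
  case: (q =P p + n) => [E|h]; last by rewrite !hval_supp // compm0.
  case: q E => [[|q]|q] E.
  - have -> : p = - n by lia.
    by rewrite psiE.
  - have z : is_zero (S q.+1) by apply: Spos.
    exact: etrans (zero_target _ z) (esym (zero_target _ z)).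
  - by rewrite comp0m phi0.
pose p0 : int := - k.+1%:Z - n.
have [|g eg] := liftR (f := phi p0 (- k.+1%:Z)).
  have := dphi p0 (- k.+2%:Z) isT.
  rewrite (@homdifE _ _ _ _ _ _ _ _ (p0 - 1) (- k.+1%:Z)) ?subrK //; last by lia.
  rewrite (phi0 _ (- k.+2%:Z)); last by lia.
  by rewrite comp0m mul0rz subr0.
have [|gam [gamE gam0]] := @homdeg_single A R S (n + 1) p0 (- k%:Z) g.
  by rewrite /p0; lia.
have [||gam' [psi E]] := IH (phi - homdif_fun n gam).
- move=> p q kq; rewrite hvalB.
  rewrite (@homdifE _ _ _ _ _ _ _ _ (p - 1) (q + 1)) ?subrK //.
  rewrite (gam0 _ q); last by right; lia.
  rewrite comp0m mul0rz subr0.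
  case: (q =P - k.+1%:Z) => [->|h]; last first.
    rewrite phi0; last by lia.
    by rewrite gam0 ?compm0 ?subrr //; right; lia.
  case: (p =P p0) => [->|h]; last first.
    rewrite hval_supp; last by rewrite /p0 in h *; lia.
    by rewrite gam0 ?compm0 ?subrr //; left.
  have -> : - k.+1%:Z + 1 = - k%:Z by lia.
  by rewrite gamE eg subrr.
- by move=> p q q0; rewrite homdif_subK; apply: dphi.
by exists (gam + gam'), psi; rewrite [homdif_fun n _](raddfD (homdif_fun n)) opprD addrA.
Qed.

Lemma postcomp_quasi_iso : quasi_iso (postcomp R (coaug_map de)).
Proof.
apply: quasi_isoI => n.
- move=> psi dpsi [phi ephi].
  have [||gam [psi' E]] := @reduce_right (n + 1) n `|(n + 1)%R|%N phi erefl.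
  + by move=> p q h; apply: homdeg_bounded; rewrite h orbT.
  + move=> p q q0; have -> : homdif_fun n phi = postcomp_fun (coaug_map de) psi by [].
    by case: q q0 => [[|q]|q] //= _; rewrite comp0m.
  exists psi'; apply: (postcomp_coaug_inj me (de := de)).
  rewrite [LHS]postcomp_comm -E homdif_subK; exact: ephi.
- move=> phi dphi.
  have n1 : n = n - 1 + 1 by rewrite subrK.
  have [||gam [psi E]] := @reduce_right n (n - 1) `|n|%N phi n1.
  + by move=> p q h; apply: homdeg_bounded; rewrite h orbT.
  + by move=> p q _; have -> : homdif_fun (n - 1) phi = 0 by [].
  have E' : homdif_fun n gam = phi - postcomp_fun (coaug_map de) psi.
    by rewrite -E subKr.
  exists psi; split; last by exists gam.
  apply: (postcomp_coaug_inj me (de := de)); rewrite [LHS]postcomp_comm -E homdif_subK.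
  by rewrite [LHS]dphi; apply: homdegP => p q; rewrite /= compm0.
Qed.

End Right.
End Reduction.

(** * Resolutions as sequences *)

Section Exactness.
Variable A : abelian.
Implicit Types X Y Z : A.

Lemma exact_at_epi X Y Z (f : hom X Y) (g : hom Y Z) :
  epimorphism f -> g = 0 -> exact_at f g.
Proof.
move=> ef ->; exists Y, (idm Y), f; split=> //; last by rewrite comp1m.
apply: kernelI; [by rewrite comp0m | exact: mono_id|].
by move=> T t _; exists t; rewrite comp1m.
Qed.

Lemma epi_exact_at X Y Z (f : hom X Y) (g : hom Y Z) :
  exact_at f g -> g = 0 -> epimorphism f.
Proof.
move=> [K [k [e [kg ee ->]]]] g0; apply: epi_comp => //.
have [|u ku] := kernel_lift (t := idm Y) kg; first by rewrite g0 comp0m.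
by apply: (@epi_of_comp _ _ _ _ _ u); rewrite ku; apply: epi_id.
Qed.

Lemma exact_at_zero X Y Z (f : hom X Y) (g : hom Y Z) : is_zero Y -> exact_at f g.
Proof.
move=> z; apply: exact_at_epi; last exact: zero_source.
by apply: epiP => T u _; apply: zero_source.
Qed.

(** [exact_at] is stated through a kernel of [g]; the dual form needs [g] factored as a cokernel [q]
    of [f] followed by a mono [m]. If [m] kills [t], then on a cover [t] lifts to [Y], the lift lies
    in the kernel of [g], and [q] kills it. *)
Lemma exact_at_op X Y Z (f : hom X Y) (g : hom Y Z) :
  exact_at f g -> @exact_at (opp_abelian A) _ _ _ g f.
Proof.
move=> [K [k [e [kg ee fE]]]].
have [Q [q kq]] := mono_ses_ex (kernel_mono kg).
have [|m mE] := ses_desc (t := g) kq; first by case: kg.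
exists Q, q, m; split; last exact: esym mE.
- apply: (@cokernelI A); first by rewrite fE compA (ses_comp0 kq) comp0m.
    exact: ses_epi kq.
  move=> T t tf; apply: (ses_desc kq); apply: (epi_eq0 ee).
  by rewrite -compA -fE.
- apply: (@monoP A) => T t mt.
  have [P [y [p [e1 _ _ ep]]]] := pullback_ex q t.
  have {}ep := ep (ses_epi kq).
  have [|w ew] := kernel_lift (t := y) kg.
    by rewrite -mE -compA e1 compA mt comp0m.
  by apply: (epi_eq0 ep); rewrite -e1 -ew compA (ses_comp0 kq) comp0m.
Qed.

Lemma exact_complexE (M : complex A) :
  exact_complex M <->
  forall i j k : int, i = j + 1 -> j = k + 1 -> exact_at (dif M i j) (dif M j k).
Proof.
split=> [ex i j k -> jk|ex n]; last by apply: ex => //; rewrite subrK.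
by have -> : k = j - 1 by rewrite jk addrK.
Qed.

End Exactness.

Lemma exact_at_unop (A : abelian) (X Y Z : A) (f : hom X Y) (g : hom Y Z) :
  @exact_at (opp_abelian A) _ _ _ g f -> exact_at f g.
Proof.
by move=> /exact_at_op [K [k [e h]]]; exists K, k, e.
Qed.

Section ResolutionSequence.
Variables (A : abelian) (P : A -> Prop).

Section FromResolution.
Variables (M : A) (R : resolution P M).

Definition res_seq : nseq A :=
  @NSeq A (fun n => if n is n'.+1 then R n' else M)
    (fun n => match n with
     | 0 => res_aug R
     | n'.+1 => dif R n'.+1 n'
     end).

Lemma res_seq_exact : nexact res_seq.
Proof.
have := res_exact R => /exact_complexE ex; split.
  exact: (epi_exact_at (ex 0 (-1) (-2) erefl erefl)).
case=> [|n]; first exact: (ex 1 0 (-1) erefl erefl).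
by apply: (ex n.+2 n.+1 n); lia.
Qed.

Lemma res_seqP : proper_res R <-> nproper P res_seq.
Proof.
split=> [pr|[pr0 pr] Q pQ].
  have {}pr Q (pQ : P Q) := (acyclic_stalk_left Q _).1 (pr Q pQ).
  split=> [Q pQ u|].
    by apply: (pr Q pQ 0 (-1) (-2) erefl erefl); rewrite /= comp0m.
  case=> [|n] Q pQ u du; first exact: (pr Q pQ 1 0 (-1) erefl erefl u du).
  by apply: (pr Q pQ n.+2 n.+1 n _ _ u du); lia.
apply/acyclic_stalk_left => i j k ij jk.
case: j ij jk => [[|n]|[|n]] ij jk.
- have -> : i = 1 by lia.
  have -> : k = -1 by lia.
  exact: (pr 0%N Q pQ).
- have -> : i = n.+2 by lia.
  have -> : k = n by lia.
  exact: (pr n.+1 Q pQ).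
- have -> : i = 0 by lia.
  by move=> u _; apply: pr0.
- by move=> u _; exists 0; rewrite compm0 (zob_target u).
Qed.

End FromResolution.

Section NatComplex.
Variable s : nseq A.

(** A complex has a map for every pair of degrees, so the differential is transported along
    [n.+1 = m] and is zero otherwise. *)
Definition natdif (m n : nat) : hom (nob s m.+1) (nob s n.+1) :=
  match n.+1 =P m with
  | ReflectT E =>
      eq_rect n.+1 (fun m => hom (nob s m.+1) (nob s n.+1)) (nd s n.+1) m E
  | _ => 0
  end.

Lemma natdifE n : natdif n.+1 n = nd s n.+1.
Proof. by rewrite /natdif; case: eqP => // E; rewrite (eq_axiomK E). Qed.

Lemma natdif0 m n : m <> n.+1 -> natdif m n = 0.
Proof. by rewrite /natdif; case: eqP => // E h; case: h. Qed.

Lemma nexact_comp0 n : nexact s -> nd s n \c nd s n.+1 = 0.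
Proof. by case=> _ /(_ n) [K [k [e [[kd _] _ ->]]]]; rewrite compA kd comp0m. Qed.

Lemma natdif_dif m n p : nexact s -> natdif n p \c natdif m n = 0.
Proof.
move=> ex; case: (m =P n.+1) => [->|/natdif0 ->]; last by rewrite compm0.
case: (n =P p.+1) => [->|/natdif0 ->]; last by rewrite comp0m.
by rewrite !natdifE nexact_comp0.
Qed.

End NatComplex.

Section ToResolution.
Variables (s : nseq A) (P0 : P zob) (Ps : forall n, P (nob s n.+1)).
Hypothesis ex : nexact s.

Definition seq_ob (i : int) : A := if i is Posz n then nob s n.+1 else zob.

Definition seq_dif (i j : int) : hom (seq_ob i) (seq_ob j) :=
  match i, j with Posz m, Posz n => natdif s m n | _, _ => 0 end.

Fact seq_dif_shape i j : i <> j + 1 -> seq_dif i j = 0.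
Proof. by case: i j => [m|m] [n|n] //= h; apply: natdif0; lia. Qed.

Fact seq_dif_dif i j k : seq_dif j k \c seq_dif i j = 0.
Proof.
case: i j k => [m|m] [n|n] [p|p] //=; rewrite ?comp0m ?compm0 //.
exact: natdif_dif.
Qed.

Definition seq_complex : complex A := Complex seq_dif_shape seq_dif_dif.

Fact seq_augK : (nd s 0 : hom (seq_complex 0) _) \c dif seq_complex 1 0 = 0.
Proof. by rewrite /= natdifE nexact_comp0. Qed.

Fact seq_aug_exact : exact_complex (augmented seq_augK).
Proof.
apply/exact_complexE => i j k ij jk; case: j ij jk => [[|n]|[|n]] ij jk.
- have -> : i = 1 by lia.
  have -> : k = -1 by lia.
  by rewrite /= natdifE; apply: ex.2.
- have -> : i = n.+2 by lia.
  have -> : k = n by lia.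
  by rewrite /= !natdifE; apply: ex.2.
- have -> : i = 0 by lia.
  have -> : k = -2 by lia.
  by apply: exact_at_epi => //; apply: ex.1.
- exact/exact_at_zero/zobP.
Qed.

Definition seq_resolution : resolution P (nob s 0).
Proof.
refine (@Resolution A P (nob s 0) seq_complex _ _ (nd s 0) seq_augK seq_aug_exact).
  by case=> n //=; apply: Ps.
by case=> n //= _; apply: zobP.
Defined.

Lemma seq_resolution_proper : nproper P s -> proper_res seq_resolution.
Proof.
move=> [pr0 pr]; apply/res_seqP; split=> //.
case=> [|n] Q pQ u; rewrite /= !natdifE.
  exact: pr 0%N Q pQ u.
exact: pr n.+1 Q pQ u.
Qed.

End ToResolution.
End ResolutionSequence.

(** * Coresolutions as sequences in the opposite category *)

Section CoresolutionSequence.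
Variables (A : abelian) (P : A -> Prop).
Let O := opp_abelian A.

Section FromCoresolution.
Variables (N : A) (S : coresolution P N).

Definition cores_seq : nseq O :=
  @NSeq O (fun n => match n with 0 => N | 1 => S 0 | n'.+2 => S (Negz n') end)
    (fun n => match n with
     | 0 => cores_aug S
     | 1 => dif S 0 (Negz 0)
     | n'.+2 => dif S (Negz n') (Negz n'.+1)
     end).

Lemma cores_seq_exact : nexact cores_seq.
Proof.
have := cores_exact S => /exact_complexE ex; split.
  exact: (epi_exact_at (exact_at_op (ex 2 1 0 erefl erefl))).
case=> [|[|n]]; apply: exact_at_op; first exact: (ex 1 0 (-1) erefl erefl).
  exact: (ex 0 (-1) (-2) erefl erefl).
by apply: (ex (Negz n) (Negz n.+1) (Negz n.+2)); lia.
Qed.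

Lemma cores_seqP : proper_cores S <-> @nproper O P cores_seq.
Proof.
split=> [pr|[pr0 pr] Q pQ].
  have {}pr Q (pQ : P Q) := (acyclic_stalk_right Q _).1 (pr Q pQ).
  split=> [Q pQ u|].
    by apply: (pr Q pQ 2 1 0 erefl erefl); rewrite /= compm0.
  case=> [|[|n]] Q pQ u du; first exact: (pr Q pQ 1 0 (-1) erefl erefl u du).
    exact: (pr Q pQ 0 (-1) (-2) erefl erefl u du).
  by apply: (pr Q pQ (Negz n) (Negz n.+1) (Negz n.+2) _ _ u du); lia.
apply/acyclic_stalk_right => i j k ij jk.
case: j ij jk => [[|[|n]]|[|n]] ij jk.
- have -> : i = 1 by lia.
  have -> : k = -1 by lia.
  exact: (pr 0%N Q pQ).
- have -> : k = 0 by lia.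
  by move=> u _; apply: pr0.
- by move=> u _; exists 0; rewrite comp0m (zob_source u).
- have -> : i = 0 by lia.
  have -> : k = -2 by lia.
  exact: (pr 1%N Q pQ).
- have -> : i = Negz n by lia.
  have -> : k = Negz n.+2 by lia.
  exact: (pr n.+2 Q pQ).
Qed.

End FromCoresolution.

Section ToCoresolution.
Variables (s : nseq O) (P0 : P zob) (Ps : forall n, P (nob s n.+1)).
Hypothesis ex : nexact s.

Definition coseq_ob (i : int) : A :=
  match i with Posz 0 => nob s 1 | Posz _ => zob | Negz n => nob s n.+2 end.

Definition coseq_dif (i j : int) : hom (coseq_ob i) (coseq_ob j) :=
  match i, j with
  | Posz 0, Negz n => natdif s n.+1 0
  | Negz m, Negz n => natdif s n.+1 m.+1
  | _, _ => 0
  end.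

Fact coseq_dif_shape i j : i <> j + 1 -> coseq_dif i j = 0.
Proof.
case: i j => [[|m]|m] [n|n] //= h; first by apply: (@natdif0 O s); lia.
by apply: (@natdif0 O s); lia.
Qed.

Fact coseq_dif_dif i j k : coseq_dif j k \c coseq_dif i j = 0.
Proof.
case: i j k => [[|m]|m] [[|n]|n] [p|p] //=; rewrite ?comp0m ?compm0 //.
  exact: (@natdif_dif O s).
exact: (@natdif_dif O s).
Qed.

Definition coseq_complex : complex A := Complex coseq_dif_shape coseq_dif_dif.

Fact coseq_augK : dif coseq_complex 0 (-1) \c (nd s 0 : hom (nob s 0 : A) _) = 0.
Proof. by rewrite /= (@natdifE O s); apply: (@nexact_comp0 O s). Qed.

Fact coseq_aug_exact : exact_complex (coaugmented coseq_augK).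
Proof.
apply/exact_complexE => i j k ij jk; case: j ij jk => [[|[|n]]|[|n]] ij jk.
- have -> : i = 1 by lia.
  have -> : k = -1 by lia.
  by rewrite /= (@natdifE O s); apply: exact_at_unop; apply: ex.2.
- have -> : i = 2 by lia.
  have -> : k = 0 by lia.
  by apply: exact_at_unop; apply: exact_at_epi => //; apply: ex.1.
- exact/exact_at_zero/zobP.
- have -> : i = 0 by lia.
  have -> : k = -2 by lia.
  by rewrite /= !(@natdifE O s); apply: exact_at_unop; apply: ex.2.
- have -> : i = Negz n by lia.
  have -> : k = Negz n.+2 by lia.
  by rewrite /= !(@natdifE O s); apply: exact_at_unop; apply: ex.2.
Qed.

Definition seq_coresolution : coresolution P (nob s 0).
Proof.
refine (@Coresolution A P (nob s 0) coseq_complex _ _ (nd s 0) coseq_augK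
  coseq_aug_exact).
  by case=> [[|n]|n] //=; apply: Ps.
by case=> [[|n]|n] //= _; apply: zobP.
Defined.

Lemma seq_coresolution_proper : @nproper O P s -> proper_cores seq_coresolution.
Proof.
move=> [pr0 pr]; apply/cores_seqP; split=> //.
case=> [|[|n]] Q pQ u; rewrite /= !(@natdifE O s).
- exact: pr 0%N Q pQ u.
- exact: pr 1%N Q pQ u.
- exact: pr n.+2 Q pQ u.
Qed.

End ToCoresolution.
End CoresolutionSequence.

(** * Balance *)

Section RelativeExt.
Variable A : abelian.
Implicit Types P Q W V X Y : A -> Prop.
Let O := opp_abelian A.

Lemma res_hat_fres P M : res_hat P M -> exists n, fres P n M.
Proof.
(* Degrees 0 to [b] may be nonzero, which makes [b.+1] terms. *)
move=> [R [b bR]]; exists b.+1.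
apply: (nexact_fres (res_seq_exact R)) => [n|n bn]; first exact: res_in.
exact: bR.
Qed.

Lemma cores_hat_fres P N : cores_hat P N -> exists n, @fres O P n N.
Proof.
move=> [S [b bS]]; exists b.+1.
apply: (nexact_fres (cores_seq_exact S)) => [[|n]|[|n] bn] //; try exact: cores_in.
by apply: bS; rewrite /=; lia.
Qed.

Lemma subcategory_zero P K : subcategory P -> is_zero K -> P K.
Proof.
move=> [P0 _ Piso] zK; apply: Piso P0; exists 0, 0; split.
  by rewrite compm0 zobP.
by rewrite compm0 zK.
Qed.

Lemma perp_fres W X n C K :
  subcategory W -> perp X W -> X C -> fres W n K -> effaced C K.
Proof.
move=> Wsub XW xC; elim: n K => [|n IH] K /=.
  by move=> zK; exact: (effaced_perp XW xC (subcategory_zero Wsub zK)).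
move=> [K1 [T [k [e [ke wT /IH eK]]]]].
exact: effaced_cokernel ke (effaced_perp XW xC wT) eK.
Qed.

(** The shift is now in the first variable. [yext] is built from its first argument, so this is not
    [perp_fres] read in the opposite category, and [effaced_kernel] is used instead. *)
Lemma perp_cofres V Y n (D K : A) :
  subcategory V -> perp V Y -> Y D -> @fres O V n K -> effaced K D.
Proof.
move=> Vsub VY yD; elim: n K => [|n IH] K /=.
  by move=> zK; apply: effaced_perp VY (@subcategory_zero V K Vsub zK) yD.
move=> [K1 [T [k [e [/ses_unop ke wT /IH eK]]]]].
exact: effaced_kernel ke (effaced_perp VY wT yD) eK.
Qed.

Lemma effaced_ext1_zero (C D : A) : effaced C D -> ext1_zero C D.
Proof. by move=> H M f g; apply: effaced_split. Qed.

(** Continue the given sequence to a proper bounded [W]-resolution of [M]. Composed with the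
    epimorphism [q] from the degree 1 term onto [K], the map [f] becomes a 1-cocycle, hence a
    coboundary of some [g] on [W0]; cancelling [q] gives the extension. *)
Lemma ExtPA_vanishes_extend W V : W zob ->
  (forall n C K, W C -> fres W n K -> ext1_zero C K) ->
  ExtPA_vanishes W (res_hat W) V ->
  forall n (K W0 M D : A) (k : hom K W0) (e : hom W0 M),
  short_exact k e -> W W0 -> fres W n K -> V D ->
  forall f : hom K D, exists g, g \c k = f.
Proof.
move=> Wz WW ExtWA0 n K W0 M D k e ke w0 wK vD f.
pose s0 := FStep ke w0 wK.
pose WW' : subclass W W := fun _ w => w.
pose s := build Wz WW' s0.
pose R := seq_resolution Wz (build_mid Wz WW' s0) (build_exact Wz WW' s0).
have Rb : res_hat W M.
  exists R; exists n => -[i|i] ni; last exact: zobP.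
  exact: (build_bounded Wz WW' (s0 := s0)).
have Rp : proper_res R by apply/seq_resolution_proper/build_proper.
have := ExtWA0 M D Rb vD R Rp 1 isT.
move=> /(@homology_stalk_right A D R 2 1 0 erefl erefl).
pose q := fout (projT2 (fsteps Wz WW' s0 1)).
move=> /(_ (f \c q)) [|g eg].
  rewrite [dif R 2 1](natdifE s 1) /=.
  by rewrite -compA (compA q) (ses_comp0 (fexact _)) comp0m compm0.
exists g; apply: (ses_epi (fexact (projT2 (fsteps Wz WW' s0 1)))).
by rewrite -/q -eg [dif R 1 0](natdifE s 0) /= compA.
Qed.

Lemma ExtAP_vanishes_lift V W : V zob ->
  (forall n C K, V C -> @fres O V n K -> @ext1_zero O C K) ->
  ExtAP_vanishes V W (cores_hat V) ->
  forall n (K V0 M D : O) (k : hom K V0) (e : hom V0 M),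
  short_exact k e -> V V0 -> @fres O V n K -> W D ->
  forall f : hom K D, exists g, g \c k = f.
Proof.
move=> Vz VV ExtAV0 n K V0 M D k e ke v0 vK wD f.
pose s0 := @FStep O V V M K V0 k e ke v0 n vK.
pose VV' : @subclass O V V := fun _ w => w.
pose s : nseq O := build Vz VV' s0.
pose S := @seq_coresolution A V s Vz (build_mid Vz VV' s0) (build_exact Vz VV' s0).
have Sb : cores_hat V M.
  exists S; exists n => -[[|i]|i] ni //; try exact: zobP.
  exact: (build_bounded Vz VV' (s0 := s0)).
have Sp : proper_cores S by apply/seq_coresolution_proper/build_proper.
have := ExtAV0 D M wD Sb S Sp 1 isT.
move=> /(@homology_stalk_left A D S 0 (-1) (-2) erefl erefl).
pose q := fout (projT2 (fsteps Vz VV' s0 1)).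
move=> /(_ (f \c q)) [|g eg].
  rewrite [dif S (-1) (-2)](natdifE s 1).
  change ((f \c q) \c (fin (projT2 (fsteps Vz VV' s0 1)) \c
    fout (projT2 (fsteps Vz VV' s0 2))) = 0).
  by rewrite -compA (compA q) (ses_comp0 (fexact _)) comp0m compm0.
exists (g : @hom O V0 D); apply: (ses_epi (fexact (projT2 (fsteps Vz VV' s0 1)))).
rewrite -/q -eg [dif S 0 (-1)](natdifE s 0).
by rewrite -compA.
Qed.

End RelativeExt.

(** * Extension along proper resolutions and coresolutions, and balance *)

Section Balance.
Variables (A : abelian) (X Y W V : A -> Prop).
Let O := opp_abelian A.
Hypotheses (X_subcat : subcategory X) (Y_subcat : subcategory Y).
Hypotheses (W_subcat : subcategory W) (V_subcat : subcategory V).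
Hypotheses (X_ext : extension_closed X) (Y_ext : extension_closed Y).
Hypotheses (W_cogen : injective_cogenerator W X).
Hypotheses (V_gen : projective_generator V Y).
Hypotheses (W_perp_Y : perp W Y) (X_perp_V : perp X V).
Hypotheses (ExtWA0 : ExtPA_vanishes W (res_hat W) V).
Hypotheses (ExtAV0 : ExtAP_vanishes V W (cores_hat V)).

Lemma X_fresW n C K : X C -> fres W n K -> ext1_zero C K.
Proof.
move=> xC wK; apply: effaced_ext1_zero.
exact: perp_fres W_subcat W_cogen.2 xC wK.
Qed.

Lemma Y_cofresV n C K : Y C -> @fres O V n K -> @ext1_zero O C K.
Proof.
move=> yC vK; apply/ext1_zero_op/effaced_ext1_zero.
exact: perp_cofres V_subcat V_gen.2 yC vK.
Qed.

Lemma resolution_extends M (R : resolution X M) :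
  res_hat X M -> proper_res R -> nextends Y (res_seq R).
Proof.
move=> /res_hat_fres [n xM] /res_seqP pr.
have [X0 _ _] := X_subcat; have [W0 _ _] := W_subcat.
have WX := W_cogen.1.1.
have WV := @ExtPA_vanishes_extend A W V W0
  (fun n C K wC => @X_fresW n C K (WX _ wC)) ExtWA0.
have WY C D : W C -> Y D -> ext1_zero C D.
  by move=> wC yD; apply/effaced_ext1_zero/(effaced_perp W_perp_Y).
apply: (@nproper_nextends A X Y W V X0 WX W_cogen.1 V_gen.1 X_fresW WY WV) => //.
- exact: (@fresX_special A X W X0 X_ext WX W_cogen.1 n).
- by move=> i; apply: res_in.
- exact: res_seq_exact.
Qed.

(** The argument for resolutions, run in the opposite category: there [V] is a cogenerator for [Y]
    and [W] a generator for [X]. *)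
Lemma coresolution_extends N (S : coresolution Y N) :
  cores_hat Y N -> proper_cores S -> @nextends O X (cores_seq S).
Proof.
move=> /cores_hat_fres [n yN] /cores_seqP pr.
have [Y0 _ _] := Y_subcat; have [V0 _ _] := V_subcat.
have VY := V_gen.1.1.
have VW := @ExtAP_vanishes_lift A V W V0
  (fun n C K vC => @Y_cofresV n C K (VY _ vC)) ExtAV0.
have VX C D : V C -> X D -> @ext1_zero O C D.
  by move=> vC xD; apply/ext1_zero_op/effaced_ext1_zero/(effaced_perp X_perp_V).
have Vcog : @cogenerator O V Y.
  split=> // T /V_gen.1.2 [T' [U [f [g [vU yT' fg]]]]].
  by exists U, T', g, f; split=> //; apply: ses_op.
have Wgen : @generator O W X.
  split=> [|T /W_cogen.1.2 [U [T' [f [g [wU xT' fg]]]]]]; first exact: W_cogen.1.1.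
  by exists T', U, g, f; split=> //; apply: ses_op.
have Yext : @extension_closed O Y.
  by move=> T1 T2 T3 f g /ses_unop fg y1 y3; apply: Y_ext fg y3 y1.
apply: (@nproper_nextends O Y X V W Y0 VY Vcog Wgen Y_cofresV VX VW) => //.
- exact: (@fresX_special O Y V Y0 Yext VY Vcog n).
- by case=> [|i]; apply: cores_in.
- exact: cores_seq_exact.
Qed.

Lemma res_hat_tilde : subclass (res_hat X) (res_tilde X).
Proof.
move=> M /res_hat_fres [n xM].
have [X0 _ _] := X_subcat; have [W0 _ _] := W_subcat.
have WX := W_cogen.1.1.
have [m [K [T [k [e [ke xT wK]]]]]] :=
  @fresX_special A X W X0 X_ext WX W_cogen.1 n M xM.
pose s0 := FStep ke xT wK.
exists (seq_resolution X0 (build_mid W0 WX s0) (build_exact W0 WX s0)).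
exact/seq_resolution_proper/build_proper/X_fresW.
Qed.

Lemma cores_hat_tilde : subclass (cores_hat Y) (cores_tilde Y).
Proof.
move=> N /cores_hat_fres [n yN].
have [Y0 _ _] := Y_subcat; have [V0 _ _] := V_subcat.
have VY := V_gen.1.1.
have Vcog : @cogenerator O V Y.
  split=> // T /V_gen.1.2 [T' [U [f [g [vU yT' fg]]]]].
  by exists U, T', g, f; split=> //; apply: ses_op.
have Yext : @extension_closed O Y.
  by move=> T1 T2 T3 f g /ses_unop fg y1 y3; apply: Y_ext fg y3 y1.
have [m [K [T [k [e [ke yT vK]]]]]] :=
  @fresX_special O Y V Y0 Yext VY Vcog n N yN.
pose s0 := @FStep O V Y N K T k e ke yT m vK.
exists (@seq_coresolution A Y (@build O V Y V0 VY N s0) Y0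
  (@build_mid O V Y V0 VY N s0) (@build_exact O V Y V0 VY N s0)).
exact/seq_coresolution_proper/build_proper/Y_cofresV.
Qed.

(** The terms of [S] lie in [Y] and those of [R] in [X], so the two extension properties supply row
    and column exactness for the reductions. *)
Lemma balance_quasi_iso M N (R : resolution X M) (S : coresolution Y N) :
  res_hat X M -> cores_hat Y N -> proper_res R -> proper_cores S ->
  quasi_iso (precomp S (res_map R)) /\ quasi_iso (postcomp R (cores_map S)).
Proof.
move=> hM hN pR pS.
have extR := resolution_extends hM pR; have extS := coresolution_extends hN pS.
split.
  apply: precomp_quasi_iso; [exact: res_neg|exact: cores_pos| | |].
  - exact: (res_seq_exact R).1.
  - by move=> k q f; apply: (extR k.+1 _ (cores_in S q) f).
  - by move=> q f; apply: (extR 0%N _ (cores_in S q) f).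
apply: postcomp_quasi_iso; [exact: res_neg|exact: cores_pos| | |].
- exact: (cores_seq_exact S).1.
- move=> [|k] p f; first exact: (extS 1%N _ (res_in R p) f).
  exact: (extS k.+2 _ (res_in R p) f).
- by move=> p f; apply: (extS 0%N _ (res_in R p) f).
Qed.

End Balance.

Theorem theorem6p7 (A : abelian) (X Y W V : A -> Prop)
  (X_subcat : subcategory X) (Y_subcat : subcategory Y)
  (W_subcat : subcategory W) (V_subcat : subcategory V)
  (WX : subclass W X) (VY : subclass V Y)
  (X_ext : extension_closed X) (Y_ext : extension_closed Y)
  (W_cogen : injective_cogenerator W X) (V_gen : projective_generator V Y)
  (W_perp_Y : perp W Y) (X_perp_V : perp X V)
  (ExtWA0 : ExtPA_vanishes W (res_hat W) V)
  (ExtAV0 : ExtAP_vanishes V W (cores_hat V)) :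
  balanced X Y (res_hat X) (cores_hat Y) /\
  (forall M N : A, res_hat X M -> cores_hat Y N ->
   forall (R : resolution X M) (S : coresolution Y N),
   proper_res R -> proper_cores S ->
   forall n : int, zmod_isomorphic (ExtPA R N n) (ExtAP M S n)).
Proof.
have Q M N hM hN R S := @balance_quasi_iso A X Y W V X_subcat Y_subcat W_subcat
  V_subcat X_ext Y_ext W_cogen V_gen W_perp_Y X_perp_V ExtWA0 ExtAV0 M N R S hM hN.
split.
  split; first exact: res_hat_tilde X_subcat W_subcat X_ext W_cogen.
    exact: cores_hat_tilde Y_subcat V_subcat Y_ext V_gen.
  by move=> M N hM hN R S; apply: Q.
move=> M N hM hN R S pR pS n; have [q1 q2] := Q M N hM hN R S pR pS.
(* Both relative Ext groups map isomorphically to the homology of Hom(R, S) in degree [- n]. *)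
exact: zmod_isomorphicI
  (@homology_map_additive _ _ (postcomp R (cores_map S)) (- n)) (q2 (- n))
  (@homology_map_additive _ _ (precomp S (res_map R)) (- n)) (q1 (- n)).
Qed.
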